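(* Let $f:\mathbb{R}^n\to\mathbb{R}$ and the randomized stochastic quasi-Newton method RSQN, with the matrices $B_{k+1}$ generated at each iteration by the stochastic cyclic-BB-like procedure SCBB with cycle length $q\ge1$, be such that AS.1, AS.2, AS.3 and AS.4 hold. Let $\epsilon>0$, let $\tilde D>0$ be a constant, and put $D_f:=f(x_1)-f^{low}$, $$C_1=\frac{4\sigma M^2D_f}{m^2\sqrt{\tilde D}}+\sigma L\sqrt{\tilde D},\qquad C_2=\frac{4LM^2D_f}{m^2}.$$ Let the positive integer $\bar N$ satisfy $$\bar N\ge\max\left\{\frac{C_1^2}{\epsilon^2}+\frac{4C_2}{\epsilon},\ \frac{\sigma^2}{L^2\tilde D}\right\},$$ and run the method with constant batch size $$m_k=\bar m:=\left\lceil\min\left\{\bar N,\max\left\{1,\frac{\sigma}{L}\sqrt{\frac{\bar N}{\tilde D}}\right\}\right\}\right\rceil,$$ maximum iteration number $N=\lfloor\bar N/\bar m\rfloor$, stepsizes $\alpha_k=m/(LM^2)$ for $k=1,\dots,N$, and $$P_R(k)=\frac{m\alpha_k-LM^2\alpha_k^2/2}{\sum_{j=1}^N(m\alpha_j-LM^2\alpha_j^2/2)},\qquad k=1,\dots,N.$$ Let $N_{sfo}$ be the total number of oracle calls made by the method (both for computing the $G_k$ and for generating the $B_{k+1}$). Then $\mathbb{E}[\|\nabla f(x_R)\|^2]\le\epsilon$ is achieved with $N_{sfo}\le\lceil(1+q)\bar N/q\rceil$; that is, to achieve $\mathbb{E}[\|\nabla f(x_R)\|^2]\le\epsilon$, $N_{sfo}$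 is at most of order $O(\epsilon^{-2})$ (as $\epsilon\to0$, with the other parameters fixed).
   Context: Problem: minimize a (possibly nonconvex) $f$ over $\mathbb{R}^n$, using only stochastic gradients $G(x,\xi)\in\mathbb{R}^n$ returned by calls to a stochastic first-order oracle (one call per evaluation of $G(x,\xi)$), where $\xi$ is a random variable whose distribution is supported on a set $\Xi\subseteq\mathbb{R}^d$ not depending on $x$. Algorithm RSQN. Given: a maximum iteration number $N$, a (deterministic) point $x_1\in\mathbb{R}^n$, a positive definite $B_1\in\mathbb{R}^{n\times n}$ (here $B_1=\lambda_1^{-1}I$ with $\lambda_1>0$), stepsizes $\alpha_k$, batch sizes $m_k\ge1$ (integers), safeguard parameters $\zeta_k\ge0$. Choose $R$ at random in $\{1,\dots,N\}$ with probability mass function $P_R$, independently of all the gradient samples. For $k=1,\dots,R$: $$G_k=\frac1{m_k}\sum_{i=1}^{m_k}G(x_k,\xi_{k,i}),\qquad x_{k+1}=x_k-\alpha_k(B_k^{-1}+\zeta_kI)G_k,$$ and then $B_{k+1}$ is generated. The output is $x_R$. (The iterates $x_1,\dots,x_N$ are regarded as defined by this recursion for all $k\le N$.) Write $\xi_k=(\xi_{k,1},\dots,\xi_{k,m_k})$ and $\xi_{[k]}=(\xi_1,\dots,\xi_k)$. The expectation of $\|\nabla f(x_R)\|^2$ is with respect to $R$ and $\xi_{[N]}$. Procedure SCBB (with parameters: a positive integer $q$ and reals $0<\lambda_{\min}<\lambda_{\max}$). Given $\lambda_k,G_k,x_k,x_{k+1},\xi_k$: if $q$ does not divide $k$, set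 $\lambda_{k+1}=\lambda_k$ (no oracle call); if $q$ divides $k$, set $s_k=x_{k+1}-x_k$ and $y_k=\frac1{m_k}\sum_{i=1}^{m_k}G(x_{k+1},\xi_{k,i})-G_k$ (this uses $m_k$ additional oracle calls), and set $\lambda_{k+1}=1$ if $s_k^{\mathsf T}y_k\le0$, while if $s_k^{\mathsf T}y_k>0$ set $\lambda_{k+1}=\mathrm P_{[\lambda_{\min},\lambda_{\max}]}\!\left(\frac{s_k^{\mathsf T}y_k}{\|y_k\|^2}\right)$ or $\lambda_{k+1}=\mathrm P_{[\lambda_{\min},\lambda_{\max}]}\!\left(\frac{\|s_k\|^2}{s_k^{\mathsf T}y_k}\right)$ (either of the two formulas may be used), where $\mathrm P_{[\lambda_{\min},\lambda_{\max}]}$ is projection onto the interval. Finally $B_{k+1}=\lambda_{k+1}^{-1}I$. Assumptions. AS.1: $f$ is continuously differentiable, $f(x)\ge f^{low}$ for all $x\in\mathbb{R}^n$, and $\nabla f$ is globally Lipschitz with constant $L>0$. AS.2: all samples $\xi_{k,i}$ are mutually independent (so $\xi_k$ is independent of $\xi_{[k-1]}$ and hence of $x_k$), and for every $k$ and $i$, taking expectation over $\xi_{k,i}$ with $x_k$ fixed, $\mathbb{E}_{\xi_{k,i}}[G(x_k,\xi_{k,i})]=\nabla f(x_k)$ and $\mathbb{E}_{\xi_{k,i}}[\|G(x_k,\xi_{k,i})-\nabla f(x_k)\|^2]\le\sigma^2$, where $\sigma>0$. AS.3: there are positive scalars $m,M$ with $mI\preceq B_k^{-1}+\zeta_kI\preceq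 MI$ for all $k$. AS.4: for every $k\ge2$, the random matrix $B_k$ depends only on $\xi_{[k-1]}$. $\|\cdot\|$ is the Euclidean norm. *)

(* Defs.v *)
From HB Require Import structures.
From mathcomp Require Export all_boot all_order all_algebra.
From mathcomp Require Export all_classical all_reals all_analysis.
Export Order.TTheory GRing.Theory Num.Theory.
Export numFieldNormedType.Exports.

Set Implicit Arguments.
Unset Strict Implicit.
Unset Printing Implicit Defensive.

Local Open Scope classical_set_scope.
Local Open Scope ring_scope.

(* Column vectors 'cV[R]_n stand for R^n.  Their library norm `|_| is the
   max-norm (same topology); [enorm] is the Euclidean norm. *)
Definition dotv (R : realType) (n : nat) (u v : 'cV[R]_n) : R :=
  \sum_(j < n) u j 0 * v j 0.

Definition enorm (R : realType) (n : nat) (v : 'cV[R]_n) : R :=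
  Num.sqrt (dotv v v).

Definition grad (R : realType) (n : nat) (f : 'cV[R]_n -> R) (x : 'cV[R]_n) :
    'cV[R]_n :=
  \col_j 'D_(delta_mx j 0) f x.

Definition loewner_le (R : realType) (n : nat) (A B : 'M[R]_n) : Prop :=
  (B - A)^T = B - A /\ forall v : 'cV[R]_n, 0 <= (v^T *m (B - A) *m v) 0 0.

Definition proj_itv (R : realType) (a b t : R) : R := Num.max a (Num.min b t).

(* Type synonym carrying the Borel sigma-algebra. *)
Notation borel T := (g_sigma_algebraType (@open T)).

Definition mutually_independent (R : realType) (dO dT : measure_display)
    (Omega : measurableType dO) (T : measurableType dT)
    (P : probability Omega R) (I : eqType) (D : set I) (X : I -> Omega -> T) :
    Prop :=
  forall (J : seq I) (A : I -> set T), uniq J -> (forall j, j \in J -> D j) ->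
    (forall j, measurable (A j)) ->
    (P (\bigcap_(j in [set` J]) X j @^-1` A j) =
     \prod_(j <- J) P (X j @^-1` A j))%E.

(* sigma-algebra generated by the X i, i in D. *)
Definition sigma_gen (dT : measure_display) (Omega : Type)
    (T : measurableType dT) (I : Type) (D : set I) (X : I -> Omega -> T) :
    set (set Omega) :=
  <<s \bigcup_(i in D) preimage_set_system setT (X i) measurable >>.

(* Indices (k, i), 1 <= k <= K, 1 <= i <= m_k, of the samples of the first K
   iterations. *)
Definition sample_idx (ms : nat -> nat) (K : nat) : set (nat * nat) :=
  [set p | (1 <= p.1 <= K)%N && (1 <= p.2 <= ms p.1)%N].

Definition minibatch (R : realType) (n d : nat)
    (G : 'cV[R]_n -> 'cV[R]_d -> 'cV[R]_n) (ms : nat -> nat) (Omega : Type)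
    (xi : nat * nat -> Omega -> 'cV[R]_d) (k : nat) (x : 'cV[R]_n) (w : Omega) :
    'cV[R]_n :=
  (ms k)%:R^-1 *: \sum_(1 <= i < (ms k).+1) G x (xi (k, i) w).

Definition scbb_update (R : realType) (n : nat) (q : nat) (lmin lmax : R)
    (k : nat) (s y : 'cV[R]_n) (lam lam' : R) : Prop :=
  if (q %| k)%N then
    if dotv s y <= 0 then lam' = 1
    else lam' = proj_itv lmin lmax (dotv s y / enorm y ^+ 2) \/
         lam' = proj_itv lmin lmax (enorm s ^+ 2 / dotv s y)
  else lam' = lam.

Definition Bmx (R : realType) (n : nat) (Omega : Type)
    (lambda : nat -> Omega -> R) (k : nat) (w : Omega) : 'M[R]_n :=
  (lambda k w)^-1%:M.

(* Iterates x and scalars lambda produced by the method, for all k <= N.  The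
   disjunction in [scbb_update] is resolved arbitrarily, possibly differently
   for each k and w. *)
Record rsqn_scbb (R : realType) (n d : nat)
    (G : 'cV[R]_n -> 'cV[R]_d -> 'cV[R]_n) (x1 : 'cV[R]_n)
    (lambda1 lmin lmax : R) (q N : nat) (ms : nat -> nat) (alpha zeta : nat -> R)
    (Omega : Type) (xi : nat * nat -> Omega -> 'cV[R]_d)
    (x : nat -> Omega -> 'cV[R]_n) (lambda : nat -> Omega -> R) : Prop := {
  rsqn_init : forall w, x 1%N w = x1;
  scbb_init : forall w, lambda 1%N w = lambda1;
  rsqn_step : forall k w, (1 <= k <= N)%N ->
    x k.+1 w = x k w - alpha k *:
      ((invmx (Bmx n lambda k w) + (zeta k)%:M) *m
       minibatch G ms xi k (x k w) w);
  scbb_step : forall k w, (1 <= k <= N)%N ->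
    scbb_update q lmin lmax k (x k.+1 w - x k w)
      (minibatch G ms xi k (x k.+1 w) w - minibatch G ms xi k (x k w) w)
      (lambda k w) (lambda k.+1 w) }.

Definition pmf_R (R : realType) (m L M : R) (alpha : nat -> R) (N k : nat) : R :=
  (m * alpha k - L * M ^+ 2 * alpha k ^+ 2 / 2) /
  \sum_(1 <= j < N.+1) (m * alpha j - L * M ^+ 2 * alpha j ^+ 2 / 2).

(* tau is the random stopping index, written R in the usual presentation of the
   method (here R is the real field). *)
Record rsqn_random (R : realType) (d : nat) (dO : measure_display)
    (Omega : measurableType dO) (P : probability Omega R) (Xi : set 'cV[R]_d)
    (N : nat) (ms : nat -> nat) (pr : nat -> R)
    (xi : nat * nat -> Omega -> 'cV[R]_d) (tau : Omega -> nat) : Prop := {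
  xi_measurable : forall p, sample_idx ms N p ->
    measurable_fun setT (xi p : Omega -> borel 'cV[R]_d);
  xi_support : forall p, sample_idx ms N p -> {ae P, forall w, Xi (xi p w)};
  tau_measurable : measurable_fun setT tau;
  tau_range : forall w, (1 <= tau w <= N)%N;
  tau_pmf : forall k, (1 <= k <= N)%N -> P (tau @^-1` [set k]) = (pr k)%:E;
  tau_indep : forall (B : set nat) (E : set Omega),
    sigma_gen (sample_idx ms N) (xi : _ -> Omega -> borel 'cV[R]_d) E ->
    (P (tau @^-1` B `&` E) = P (tau @^-1` B) * P E)%E }.

Record AS1 (R : realType) (n : nat) (f : 'cV[R]_n -> R) (flow L : R) : Prop := {
  AS1_diff : forall x, differentiable f x;
  AS1_cont : continuous (grad f);
  AS1_low : forall x, flow <= f x;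
  AS1_lip : forall x y, enorm (grad f x - grad f y) <= L * enorm (x - y) }.

(* "Expectation over xi_{k,i} with x_k fixed": x_k is frozen at its value x k w
   and the sample is integrated over an independent variable w'.  An 'E_P[_]
   equal to a finite value entails integrability. *)
Record AS2 (R : realType) (n d : nat) (f : 'cV[R]_n -> R)
    (G : 'cV[R]_n -> 'cV[R]_d -> 'cV[R]_n) (sigma : R) (dO : measure_display)
    (Omega : measurableType dO) (P : probability Omega R) (N : nat)
    (ms : nat -> nat) (xi : nat * nat -> Omega -> 'cV[R]_d)
    (x : nat -> Omega -> 'cV[R]_n) : Prop := {
  AS2_indep : mutually_independent P (sample_idx ms N)
    (xi : _ -> Omega -> borel 'cV[R]_d);
  AS2_mean : forall k i, sample_idx ms N (k, i) ->
    {ae P, forall w, forall j : 'I_n,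
      'E_P[(fun w' => G (x k w) (xi (k, i) w') j 0)%R]%E =
      (grad f (x k w) j 0)%:E};
  AS2_var : forall k i, sample_idx ms N (k, i) ->
    {ae P, forall w,
      ('E_P[(fun w' =>
         enorm (G (x k w) (xi (k, i) w') - grad f (x k w)) ^+ 2)%R]
       <= (sigma ^+ 2)%:E)%E} }.

Definition AS3 (R : realType) (n : nat) (m M : R) (dO : measure_display)
    (Omega : measurableType dO) (P : probability Omega R) (N : nat)
    (zeta : nat -> R) (B : nat -> Omega -> 'M[R]_n) : Prop :=
  forall k, (1 <= k <= N)%N -> {ae P, forall w,
    loewner_le m%:M (invmx (B k w) + (zeta k)%:M) /\
    loewner_le (invmx (B k w) + (zeta k)%:M) M%:M}.

Definition AS4 (R : realType) (n d : nat) (Omega : Type) (N : nat)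
    (ms : nat -> nat) (xi : nat * nat -> Omega -> 'cV[R]_d)
    (B : nat -> Omega -> 'M[R]_n) : Prop :=
  forall k, (2 <= k <= N)%N -> forall A : set (borel 'M[R]_n), measurable A ->
    sigma_gen (sample_idx ms k.-1) (xi : _ -> Omega -> borel 'cV[R]_d)
      (B k @^-1` A).

(* Oracle calls made when iterations 1..K are performed. *)
Definition sfo_calls (q : nat) (ms : nat -> nat) (K : nat) : nat :=
  \sum_(1 <= k < K.+1) (ms k + (if q %| k then ms k else 0))%N.

Definition C1 (R : realType) (sigma L m M Dt Df : R) : R :=
  4 * sigma * M ^+ 2 * Df / (m ^+ 2 * Num.sqrt Dt) + sigma * L * Num.sqrt Dt.

Definition C2 (R : realType) (L m M Df : R) : R :=
  4 * L * M ^+ 2 * Df / m ^+ 2.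

Definition budget_ok (R : realType) (sigma L m M Dt Df eps : R) (Nbar : nat) :
    Prop :=
  (0 < Nbar)%N /\
  Num.max (C1 sigma L m M Dt Df ^+ 2 / eps ^+ 2 + 4 * C2 L m M Df / eps)
          (sigma ^+ 2 / (L ^+ 2 * Dt)) <= Nbar%:R.

Definition batch_size (R : realType) (sigma L Dt : R) (Nbar : nat) : nat :=
  absz (Num.ceil (Num.min Nbar%:R
    (Num.max 1 (sigma / L * Num.sqrt (Nbar%:R / Dt))))).

(* Main.v *)
(** One step of the method with [m <= h <= M], where [h = lambda_k + zeta_k], and
    [alpha = m / (L M^2)] satisfies, by the descent lemma,
    [f x_(k+1) + beta |g_k|^2 <= f x_k + c <g_k, e_k> + beta |e_k|^2],
    where [g_k] is the gradient at [x_k], [e_k] the noise of the minibatch and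
    [beta = m^2 / (2 L M^2)].  Since [x_k] and [h] only depend on earlier samples,
    the cross term has mean zero and [E |e_k|^2 <= sigma^2 / mbar].  Telescoping
    and averaging over the uniform stopping index gives
    [E |g_R|^2 <= 2 L M^2 Df / (m^2 N) + sigma^2 / mbar], and the choice of
    [mbar] and [Nbar] makes the right-hand side at most [eps]. *)

(* Two obstacles shape the proof. First, AS.2 freezes [x k] and averages over one fresh sample,
   whereas the cross term is integrated over everything at once. No conditional expectation is
   formed: depending only on earlier samples means being measurable for the sigma-algebra of
   [past D X]. The resulting orthogonality is used twice: inside a minibatch, between a partial sum
   and the noise of the next sample, and across iterations, between a multiple of the gradient and
   the batch noise. The same freezing separates [tau] from the iterates. Second, every integral must
   be known to be finite before it is split. A gradient step of length [1 / L] shows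
   [|grad f|^2 <= 2 L (f - flow)], so integrability of [f (x k) - flow] is the single invariant of
   the induction: it yields square integrability of the gradient and of the vector [V] multiplying
   the noise. The order [eps^-2] concerns the least admissible [Nbar], since every larger budget is
   admissible too. *)
From HB Require Import structures.
Require Import Defs.
From mathcomp Require Import measurable_realfun ring lra zify.

Set Implicit Arguments.
Unset Strict Implicit.
Unset Printing Implicit Defensive.

Local Open Scope classical_set_scope.
Local Open Scope ring_scope.

(** * Euclidean geometry and smooth functions *)

Section euclid.
Context (R : realType) (n : nat).
Implicit Types (u v w : 'cV[R]_n).

Lemma dotvC u v : dotv u v = dotv v u.
Proof. by apply: eq_bigr => j _; rewrite mulrC. Qed.

Lemma dotvDl u v w : dotv (u + v) w = dotv u w + dotv v w.
Proof. by rewrite /dotv -big_split; apply: eq_bigr => j _; rewrite !mxE mulrDl. Qed.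

Lemma dotvZl a u v : dotv (a *: u) v = a * dotv u v.
Proof. by rewrite /dotv mulr_sumr; apply: eq_bigr => j _; rewrite mxE mulrA. Qed.

Lemma dotvNl u v : dotv (- u) v = - dotv u v.
Proof. by rewrite -scaleN1r dotvZl mulN1r. Qed.

Lemma dotvDr u v w : dotv u (v + w) = dotv u v + dotv u w.
Proof. by rewrite dotvC dotvDl ![dotv _ u]dotvC. Qed.

Lemma dotvZr a u v : dotv u (a *: v) = a * dotv u v.
Proof. by rewrite dotvC dotvZl dotvC. Qed.

Lemma dotvNr u v : dotv u (- v) = - dotv u v.
Proof. by rewrite dotvC dotvNl dotvC. Qed.

Lemma dotv_ge0 u : 0 <= dotv u u.
Proof. by apply: sumr_ge0 => j _; rewrite -expr2 sqr_ge0. Qed.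

Lemma sqr_enorm u : enorm u ^+ 2 = dotv u u.
Proof. exact/sqr_sqrtr/dotv_ge0. Qed.

Lemma enorm_ge0 u : 0 <= enorm u.
Proof. exact: sqrtr_ge0. Qed.

(** Cauchy-Schwarz: for [v] nonzero, the squared length of [dotv v v *: u - dotv u v *: v] is
    [dotv v v] times the defect [|u|^2 |v|^2 - (dotv u v)^2]. *)
Lemma dotv_le_enorm u v : dotv u v <= enorm u * enorm v.
Proof.
have [v0|v0] := eqVneq (dotv v v) 0.
  suff -> : v = 0.
    by rewrite dotvC -(scale0r 0) dotvZl mul0r mulr_ge0 ?enorm_ge0.
  apply/colP => j; rewrite mxE; apply/eqP; rewrite -sqrf_eq0 expr2.
  by move/eqP: v0; rewrite psumr_eq0 => [/allP/(_ j)|i _];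
    rewrite ?mem_index_enum -?expr2 ?sqr_ge0//; exact.
have vgt0 : 0 < dotv v v by rewrite lt_neqAle eq_sym v0 dotv_ge0.
rewrite -sqrtrM ?dotv_ge0//; apply: le_trans (ler_norm _) _.
rewrite -sqrtr_sqr ler_sqrt ?mulr_ge0 ?dotv_ge0//.
have := dotv_ge0 (dotv v v *: u - dotv u v *: v).
rewrite dotvDl !dotvDr !dotvNl !dotvNr !dotvZl !dotvZr (dotvC v u) => H.
rewrite -(ler_pM2l vgt0); lra.
Qed.

Lemma dotv_sumr (I : Type) (s : seq I) (P : pred I) (F : I -> 'cV[R]_n) u :
  dotv u (\sum_(i <- s | P i) F i) = \sum_(i <- s | P i) dotv u (F i).
Proof.
apply: (big_morph (dotv u)) => [v w|]; first exact: dotvDr.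
by rewrite -(scale0r 0) dotvZr mul0r.
Qed.

Lemma diff_dotv_grad (f : 'cV[R]_n -> R) x v : differentiable f x ->
  'd f x v = dotv (grad f x) v.
Proof.
move=> df; rewrite {1}(matrix_sum_delta v) linear_sum/=.
apply: eq_bigr => j _; rewrite big_ord1 linearZ/= mxE deriveE// mulrC.
by rewrite [_ *: _]mulrC mulrC.
Qed.

End euclid.

Section smooth.
Context (R : realType) (n : nat) (f : 'cV[R]_n -> R) (L : R).
Hypothesis df : forall x, differentiable f x.
Hypothesis lip : forall x y, enorm (grad f x - grad f y) <= L * enorm (x - y).

Lemma is_derive_along_line x d (t : R) :
  is_derive t 1 (fun s : R => f (x + s *: d)) (dotv (grad f (x + t *: d)) d).
Proof.
have E : (fun h : R => h^-1 *: (((fun s => f (x + s *: d)) \o shift t) (h *: 1)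
    - f (x + t *: d))) =
  (fun h : R => h^-1 *: ((f \o shift (x + t *: d)) (h *: d) - f (x + t *: d))).
  apply/funext => h /=; congr (_ *: (f _ - _)).
  by rewrite [h *: 1]mulr1 scalerDl addrCA.
split; first by rewrite /derivable E; exact: diff_derivable.
by rewrite -diff_dotv_grad// -deriveE// /derive E.
Qed.

(** Subtracting the quadratic model along the segment leaves a function [h] with nonpositive
    derivative on (0, 1), by Cauchy-Schwarz and the Lipschitz bound. The mean value theorem gives
    [h 1 <= h 0], without integrating the gradient. *)
Lemma descent x y :
  f y <= f x + dotv (grad f x) (y - x) + L / 2 * dotv (y - x) (y - x).
Proof.
set d := y - x; set a := dotv _ d; set b := dotv d d.
pose h (t : R) := f (x + t *: d) - (t * a + L / 2 * b * t ^+ 2).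
pose dh (t : R) := dotv (grad f (x + t *: d)) d - (a + L * b * t).
have Dh (t : R) : is_derive t 1 h (dh t).
  have D1 := is_derive_along_line x d t.
  have -> : h = (fun s => f (x + s *: d)) - (a *: id + (L / 2 * b) *: id ^+ 2).
    by apply/funext => s; rewrite /h/= mulrC.
  apply: is_derive_eq.
  by rewrite /dh /GRing.scale/= expr1; lra.
have ch : {within `[0, 1], continuous h}.
  apply: derivable_within_continuous => t _.
  by have [] := Dh t.
have [c] := MVT ltr01 (fun t _ => Dh t) ch.
rewrite in_itv/= => /andP[c0 c1].
have : dh c <= 0.
  have -> : dh c = dotv (grad f (x + c *: d) - grad f x) d - L * b * c.
    by rewrite dotvDl dotvNl -/a /dh; ring.
  rewrite subr_le0; apply: le_trans (dotv_le_enorm _ _) _.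
  apply: le_trans (ler_wpM2r (enorm_ge0 _) (lip _ _)) _.
  rewrite addrC addKr /b -sqr_enorm.
  have -> : enorm (c *: d) = c * enorm d.
    rewrite /enorm dotvZl dotvZr mulrA -expr2 sqrtrM ?sqr_ge0//.
    by rewrite sqrtr_sqr ger0_norm// ltW.
  by rewrite le_eqVlt; apply/orP; left; apply/eqP; ring.
rewrite /h scale0r scale1r /d addr0 subrKC !subr0 mulr1.
rewrite expr1n expr0n/= !mulr0 mul0r; lra.
Qed.

(** A gradient step of length [1 / L] lowers [f] by at least [|g|^2 / (2 L)], and [f] cannot fall
    below [flow]. *)
Lemma sqr_grad_le (flow : R) x : 0 < L -> (forall y, flow <= f y) ->
  dotv (grad f x) (grad f x) <= 2 * L * (f x - flow).
Proof.
move=> L0 fl; set g := grad f x.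
have := descent x (x - L^-1 *: g); have := fl (x - L^-1 *: g).
rewrite (addrAC x) subrr add0r !dotvNr !dotvNl !dotvZr !dotvZl -/g.
set b := dotv g g => h1 h2.
have : L^-1 / 2 * b <= f x - flow.
  have -> : L^-1 / 2 * b = L^-1 * b - L / 2 * - - (L^-1 * (L^-1 * b)).
    by field; rewrite gt_eqF.
  lra.
move=> h; have -> : b = 2 * L * (L^-1 / 2 * b) by field; rewrite gt_eqF.
by rewrite ler_pM2l // mulr_gt0.
Qed.

End smooth.

(** * Evaluation budget *)

Section budget.
Context (R : realType) (sigma L m M Dt Df : R).
Hypotheses (L0 : 0 < L) (sigma0 : 0 < sigma) (m0 : 0 < m) (M0 : 0 < M)
  (Dt0 : 0 < Dt) (Df0 : 0 <= Df).

(** The ceiling is nonnegative, so [absz] loses nothing and comparisons can be made on integers. *)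
Lemma batch_sizeE Nbar : (0 < Nbar)%N ->
  (batch_size sigma L Dt Nbar)%:Z =
  Num.ceil (Num.min (Nbar%:R : R)
    (Num.max 1 (sigma / L * Num.sqrt (Nbar%:R / Dt)))).
Proof.
move=> N0; rewrite /batch_size gez0_abs// ceil_ge0.
rewrite lt_min; apply/andP; split; first by rewrite (lt_le_trans _ (ler0n _ _)).
by rewrite lt_max (lt_trans (ltrN10 R) ltr01).
Qed.

Lemma batch_size_gt0 Nbar : (0 < Nbar)%N -> (0 < batch_size sigma L Dt Nbar)%N.
Proof.
move=> N0; rewrite -ltz_nat batch_sizeE// ceil_gt0.
by rewrite lt_min ltr0n N0 lt_max ltr01.
Qed.

Lemma batch_size_le Nbar : (0 < Nbar)%N ->
  (batch_size sigma L Dt Nbar <= Nbar)%N.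
Proof.
move=> N0; rewrite -lez_nat batch_sizeE// ceil_le_int.
by rewrite ge_min lexx.
Qed.

Lemma batch_size_ub Nbar : (0 < Nbar)%N ->
  (batch_size sigma L Dt Nbar)%:R <= 1 + sigma / L * Num.sqrt (Nbar%:R / Dt).
Proof.
move=> N0; set a := _ * _.
have a0 : 0 <= a by rewrite mulr_ge0 ?sqrtr_ge0// divr_ge0// ltW.
(* For [a <= 1] the general estimate [max 1 a + 1] would only give 2; the batch size is then at most
   1. *)
have [a1|a1] := leP a 1.
  suff : (batch_size sigma L Dt Nbar <= 1)%N.
    by rewrite -(ler_nat R) => h; apply: le_trans h _; rewrite lerDl.
  rewrite -lez_nat batch_sizeE// ceil_le_int -/a.
  by rewrite ge_min ge_max lexx a1 orbT.
have : ((batch_size sigma L Dt Nbar)%:Z)%:~R < 1 + a.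
  rewrite batch_sizeE// addrC -ltrBlDr -[X in _ - X]/(1%:~R) -intrB.
  rewrite (lt_le_trans (ceilB1_lt _))//.
  by rewrite -/a ge_min ge_max lexx (ltW a1) orbT.
by move/ltW.
Qed.

Lemma batch_size_lb Nbar : (0 < Nbar)%N ->
  Num.min Nbar%:R (sigma / L * Num.sqrt (Nbar%:R / Dt)) <=
  (batch_size sigma L Dt Nbar)%:R.
Proof.
move=> N0; rewrite -[leRHS]/(((batch_size sigma L Dt Nbar)%:Z)%:~R).
rewrite batch_sizeE//; apply: le_trans (ceil_ge _).
by rewrite le_min2// le_max lexx orbT.
Qed.

(** With [s = sqrt Nbar], the two error terms add up to at most [(C1 s + C2) / s^2]. What remains is
    the quadratic inequality [C1 s + C2 <= eps s^2], which the first member of the budget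
    supplies. *)
Lemma rate_le_eps eps Nbar (b := batch_size sigma L Dt Nbar) (N := (Nbar %/ b)%N) :
  0 < eps -> budget_ok sigma L m M Dt Df eps Nbar ->
  2 * L * M ^+ 2 / m ^+ 2 * Df / N%:R + sigma ^+ 2 / b%:R <= eps.
Proof.
move=> e0 [N0]; rewrite ge_max => /andP[hN1 hN2].
have b0 : (0 < b)%N by exact: batch_size_gt0.
have bN : (b <= Nbar)%N by exact: batch_size_le.
(* As [N >= 1], the floor loses at most a factor 2: [Nbar < (N + 1) b <= 2 N b]. This is the source
   of the 4, in place of 2, in [C2]. *)
have bN2 : (Nbar <= 2 * (N * b))%N.
  have h1 := divn_eq Nbar b; have h2 := ltn_pmod Nbar b0.
  have h3 : (0 < N)%N by rewrite divn_gt0.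
  by rewrite -/N in h1; nia.
have N0' : (0 < N)%N by rewrite divn_gt0.
set s := Num.sqrt (Nbar%:R : R); set r := Num.sqrt Dt.
have s0 : 0 < s by rewrite sqrtr_gt0 ltr0n.
have r0 : 0 < r by rewrite sqrtr_gt0.
have sE : Nbar%:R = s ^+ 2 :> R by rewrite sqr_sqrtr// ler0n.
have rE : Dt = r ^+ 2 by rewrite sqr_sqrtr// ltW.
have srE : Num.sqrt (Nbar%:R / Dt) = s / r.
  by rewrite sqrtrM ?ler0n// sqrtrV// ltW.
have ub := batch_size_ub N0; rewrite srE -/b in ub.
have lb := batch_size_lb N0; rewrite srE -/b sE in lb.
rewrite -/r sE in hN1; rewrite rE sE in hN2.
have bR : 0 < b%:R :> R by rewrite ltr0n.
have NR : 0 < N%:R :> R by rewrite ltr0n.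
have [L0' m0' s0' r0'] : [/\ L != 0, m != 0, s != 0 & r != 0].
  by rewrite !gt_eqF.
have NR' : N%:R != 0 :> R by rewrite gt_eqF.
(* This is the square root of the second member of the budget; it serves the case where the minimum
   defining the batch size is [Nbar]. *)
have sLr : sigma / (L * r) <= s.
  have q0 : 0 <= sigma / (L * r) by rewrite divr_ge0 ?mulr_ge0// ltW.
  rewrite -ler_sqr ?nnegrE//; last exact: ltW.
  by rewrite expr_div_n exprMn.
have sLr2 : sigma <= s * (L * r) by rewrite -ler_pdivrMr// mulr_gt0.
have T2 : sigma ^+ 2 / b%:R <= sigma * L * r / s.
  rewrite ler_pdivrMr//.
  have k0 : 0 < sigma * L * r / s by rewrite divr_gt0 ?mulr_gt0.
  apply: le_trans (ler_wpM2l (ltW k0) lb).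
  rewrite minr_pMr ?(ltW k0)// le_min; apply/andP; split; last first.
    by rewrite le_eqVlt; apply/orP; left; apply/eqP; field; rewrite s0' r0' L0'.
  have -> : sigma * L * r / s * s ^+ 2 = sigma * (s * (L * r)).
    by field.
  by rewrite expr2 ler_pM2l.
set c2 := C2 L m M Df; set c1 := C1 sigma L m M Dt Df.
have c20 : 0 <= c2.
  by rewrite divr_ge0 ?exprn_ge0 ?mulr_ge0 ?exprn_ge0 ?(ltW L0) ?(ltW m0) ?(ltW M0).
(* The left side is [c2 / (2 N)], at most [c2 b / Nbar]; the upper bound on [b] splits this into the
   [C2] term and the first summand of [C1]. *)
have T1 : 2 * L * M ^+ 2 / m ^+ 2 * Df / N%:R <=
    c2 / s ^+ 2 + 4 * sigma * M ^+ 2 * Df / (m ^+ 2 * r) / s.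
  have -> : 2 * L * M ^+ 2 / m ^+ 2 * Df / N%:R = c2 * (2 * N%:R)^-1.
    by rewrite /c2 /C2; field; rewrite NR' m0'.
  have -> : c2 / s ^+ 2 + 4 * sigma * M ^+ 2 * Df / (m ^+ 2 * r) / s =
      c2 * ((1 + sigma / L * (s / r)) / s ^+ 2).
    by rewrite /c2 /C2; field; rewrite m0' r0' s0' L0'.
  rewrite ler_wpM2l//; apply: (@le_trans _ _ (b%:R / s ^+ 2)); last first.
    by rewrite ler_pM2r ?invr_gt0 ?exprn_gt0.
  rewrite ler_pdivlMr ?exprn_gt0// ler_pdivrMl ?mulr_gt0//.
  by move: bN2; rewrite -(ler_nat R) sE !natrM mulrA.
have es : c1 ^+ 2 / eps + 4 * c2 <= eps * s ^+ 2.
  rewrite -ler_pdivrMl// mulrDr; apply: le_trans hN1.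
  by rewrite -/c1 -/c2 le_eqVlt; apply/orP; left; apply/eqP; field; rewrite gt_eqF.
have h : c1 * s + c2 <= eps * s ^+ 2.
  (* Arithmetic-geometric mean inequality, from the square of [c1 - eps * s]. Together with [es] it
     leaves a slack of [c2]. *)
  have : 2 * (c1 * s) <= c1 ^+ 2 / eps + eps * s ^+ 2.
    rewrite -subr_ge0.
    have -> : c1 ^+ 2 / eps + eps * s ^+ 2 - 2 * (c1 * s) =
        (c1 - eps * s) ^+ 2 / eps by field; rewrite gt_eqF.
    by rewrite divr_ge0 ?sqr_ge0 ?ltW.
  lra.
apply: le_trans (lerD T1 T2) _.
have -> : c2 / s ^+ 2 + 4 * sigma * M ^+ 2 * Df / (m ^+ 2 * r) / s +
   sigma * L * r / s = (c1 * s + c2) / s ^+ 2.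
  by rewrite /c1 /C1 -/r; field; rewrite m0' r0' s0'.
by rewrite ler_pdivrMr// exprn_gt0.
Qed.

End budget.

Lemma sfo_calls_le (q K Nbar b : nat) : (0 < q)%N ->
  (K <= Nbar %/ b)%N ->
  (q * sfo_calls q (fun=> b) K <= (1 + q) * Nbar)%N.
Proof.
move=> q0 KN.
suff E : (q * sfo_calls q (fun=> b) K <= (1 + q) * (K * b))%N.
  apply: leq_trans E _; rewrite leq_mul2l/=.
  by apply: leq_trans (leq_trunc_div Nbar b); rewrite leq_mul2r KN orbT.
(* Exact count: one batch per iteration, and one more for each multiple of [q] up to [K]. *)
suff E : (sfo_calls q (fun=> b) K = K * b + K %/ q * b)%N.
  by rewrite E; have := leq_trunc_div K q; nia.
rewrite /sfo_calls; elim: K {KN} => [|K IH].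
  by rewrite big_geq// div0n.
rewrite big_nat_recr//= IH divnS//.
by case: ifP => _ /=; nia.
Qed.

Lemma sfo_calls_le_ceil (R : realType) (q K Nbar b : nat) : (0 < q)%N ->
  (K <= Nbar %/ b)%N ->
  (sfo_calls q (fun=> b) K)%:Z <= Num.ceil (((1 + q) * Nbar)%:R / q%:R : R).
Proof.
move=> q0 KN; rewrite -(ler_int R); apply: le_trans (ceil_ge _).
rewrite ler_pdivlMr ?ltr0n// -[X in X * _]/((sfo_calls q (fun=> b) K)%:R).
by rewrite -natrM ler_nat mulnC sfo_calls_le.
Qed.

(** * Order of the oracle count for the least admissible budget *)

Section budget_bound.
Context (R : realType) (sigma L m M Dt Df : R) (q : nat).
Hypotheses (q0 : (0 < q)%N) (L0 : 0 < L) (sigma0 : 0 < sigma) (m0 : 0 < m) (M0 : 0 < M)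
  (Dt0 : 0 < Dt) (Df0 : 0 <= Df).

Definition min_budget eps : R :=
  Num.max (C1 sigma L m M Dt Df ^+ 2 / eps ^+ 2 + 4 * C2 L m M Df / eps)
          (sigma ^+ 2 / (L ^+ 2 * Dt)).

Lemma budget_const_gt0 : 0 < sigma ^+ 2 / (L ^+ 2 * Dt).
Proof. by rewrite divr_gt0 ?mulr_gt0 ?exprn_gt0. Qed.

(** The [+ 1] pays for rounding the threshold [min_budget] up to an integer. *)
Definition sfo_bound eps : R := (1 + q)%:R / q%:R * (min_budget eps + 1).

(** The ceiling of the threshold is itself admissible, so the least admissible [Nbar] does not
    exceed it. *)
Lemma min_budget_le eps Nbar :
  (forall N', budget_ok sigma L m M Dt Df eps N' -> (Nbar <= N')%N) ->
  Nbar%:R <= min_budget eps + 1.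
Proof.
move=> minN.
have b0 : 0 < min_budget eps by rewrite lt_max budget_const_gt0 orbT.
have c0 : 0 < Num.ceil (min_budget eps) by rewrite ceil_gt0.
have E : (`|Num.ceil (min_budget eps)|%N)%:Z = Num.ceil (min_budget eps).
  by rewrite gez0_abs// ltW.
have le : (Nbar <= `|Num.ceil (min_budget eps)|)%N.
  apply: minN; split; first by rewrite -ltz_nat E.
  rewrite -/(min_budget eps) -[leRHS]/((`|Num.ceil (min_budget eps)|%N)%:Z%:~R).
  by rewrite E ceil_ge.
apply: (@le_trans _ _ ((`|Num.ceil (min_budget eps)|%N)%:Z%:~R)).
  by rewrite [leRHS]/(_%:R) ler_nat.
rewrite E -lerBlDr -[X in _ - X]/(1%:~R) -intrB ltW//.
exact: ceilB1_lt.
Qed.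

Lemma sfo_calls_le_bound eps Nbar K b : (K <= Nbar %/ b)%N ->
  (forall N', budget_ok sigma L m M Dt Df eps N' -> (Nbar <= N')%N) ->
  (sfo_calls q (fun=> b) K)%:R <= sfo_bound eps.
Proof.
move=> KN minN.
have qR : 0 < q%:R :> R by rewrite ltr0n.
rewrite /sfo_bound mulrAC ler_pdivlMr// -natrM mulnC.
apply: le_trans (_ : ((1 + q) * Nbar)%:R <= _).
  by rewrite ler_nat sfo_calls_le.
by rewrite natrM ler_wpM2l// min_budget_le.
Qed.

(** For [0 < eps <= 1] both [1] and [1 / eps] are at most [eps^-2], so the coefficients of the
    threshold may simply be added. *)
Lemma sfo_bound_bigO : sfo_bound =O_ (0^'+) (fun eps : R => eps ^- 2).
Proof.
set c1 := C1 sigma L m M Dt Df; set c2 := C2 L m M Df.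
set c3 := sigma ^+ 2 / (L ^+ 2 * Dt).
have c20 : 0 <= c2.
  by rewrite divr_ge0 ?exprn_ge0 ?mulr_ge0 ?exprn_ge0 ?(ltW L0) ?(ltW m0) ?(ltW M0).
have c30 : 0 < c3 := budget_const_gt0.
apply/eqO_exP; exists ((1 + q)%:R / q%:R * (c1 ^+ 2 + 4 * c2 + c3 + 1)); last first.
  near=> eps.
  have e0 : 0 < eps by near: eps; exact: nbhs_right_gt.
  have e1 : eps <= 1 by near: eps; apply: nbhs_right_le.
  have i1 : 1 <= eps^-1 by rewrite invf_ge1.
  have i2 : eps^-1 <= eps ^- 2.
    by rewrite -exprVn expr2 ler_peMl// invr_ge0 ltW.
  have b0 : 0 <= min_budget eps + 1.
    by rewrite addr_ge0// le_max (ltW c30) orbT.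
  rewrite /sfo_bound !ger0_norm ?invr_ge0 ?exprn_ge0 ?(ltW e0)//; last first.
    by rewrite mulr_ge0// divr_ge0.
  rewrite -[leRHS]mulrA ler_wpM2l ?divr_ge0//.
  rewrite -[leRHS]addr0 -[X in _ <= _ + X](subrr 1) addrA addrAC lerD2r.
  rewrite /min_budget -/c1 -/c2 -/c3 ge_max.
  have h1 := sqr_ge0 c1.
  set i := eps^-1 in i1 i2 *; set j := eps ^- 2 in i2 *.
  have j1 : 1 <= j by apply: le_trans i1 i2.
  have a1 : 4 * c2 * i <= 4 * c2 * j by rewrite ler_wpM2l// mulr_ge0.
  have a2 : c3 <= c3 * j by rewrite ler_peMr// ltW.
  have a3 : 0 <= c2 * j by rewrite mulr_ge0// (le_trans _ j1).
  have a4 : 0 <= c1 ^+ 2 * j by rewrite mulr_ge0// (le_trans _ j1).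
  by apply/andP; split; rewrite !mulrDl; lra.
apply: mulr_gt0; first by rewrite divr_gt0 ?ltr0n.
have h1 := sqr_ge0 c1; lra.
Unshelve. all: by end_near. Qed.

End budget_bound.

(** * Borel measurability, independence and freezing *)

Section borel.
Context (R : realType) (n : nat).

Lemma continuous_measurable_borel (f : 'cV[R]_n -> R) : continuous f ->
  measurable_fun setT (f : borel 'cV[R]_n -> R).
Proof.
move=> cf; apply: (measurability _ (RGenOpens.measurableE R)).
move=> _ [_ [a [b ->] <-]]; rewrite setTI; apply: sub_sigma_algebra.
by move/continuousP : cf; apply; exact: interval_open.
Qed.

Lemma continuous_measurable_borelV (f : 'cV[R]_n -> 'cV[R]_n) : continuous f ->
  measurable_fun setT (f : borel 'cV[R]_n -> borel 'cV[R]_n).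
Proof.
move=> cf; apply: (@measurability _ _ _ (borel _) _ _ (@open _) erefl).
move=> _ [A oA <-]; rewrite setTI; apply: sub_sigma_algebra.
by move/continuousP : cf; apply.
Qed.

Lemma measurable_coord (j : 'I_n) :
  measurable_fun setT ((fun v => v j 0) : borel 'cV[R]_n -> R).
Proof.
apply: (@continuous_measurable_borel (fun v => v j 0)).
exact: coord_continuous.
Qed.

(* An open set is a countable union of boxes with rational centre and radius. *)
Lemma measurable_fun_coords (dO : measure_display) (T : measurableType dO)
    (F : T -> 'cV[R]_n) :
  (forall j, measurable_fun setT (fun w => F w j 0)) ->
  measurable_fun setT (F : T -> borel 'cV[R]_n).
Proof.
move=> mF; apply: (@measurability _ _ _ (borel _) _ _ (@open _) erefl).
move=> _ [U oU <-]; rewrite setTI.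
pose box (c : 'cV[rat]_n * rat) : set 'cV[R]_n :=
  [set v | forall j, `|v j 0 - ratr (c.1 j 0)| < ratr c.2].
pose Fb (c : 'cV[rat]_n * rat) :=
  if `[< box c `<=` U >] then F @^-1` box c else set0.
have -> : F @^-1` U = \bigcup_c Fb c.
  apply/seteqP; split => [w /= Uw|w [c _]]; last first.
    by rewrite /Fb; case: asboolP => // h /h.
  have /nbhs_ballP[e /= e0 eU] : nbhs (F w) U by exact: open_nbhs_nbhs.
  (* A rational radius below [e / 2] makes any two points of the box differ by less than [e] in each
     coordinate, so a box containing [F w] stays in the ball. *)
  have e20 : 0 < e / 2 by rewrite divr_gt0.
  have [r /[!in_itv]/= /andP[r0 re]] := rat_in_itvoo e20.
  have /choice[c hc] (j : 'I_n) : exists c : rat, `|F w j 0 - ratr c| < ratr r.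
    have /rat_in_itvoo[c] : F w j 0 - ratr r < F w j 0 + ratr r by lra.
    rewrite in_itv/= => /andP[h1 h2]; exists c.
    by rewrite ltr_distl; apply/andP; split; lra.
  exists (\col_j c j, r) => //; rewrite /Fb asboolT => /=.
    by move=> j; rewrite mxE.
  move=> v hv; apply: eU; split => // i j; rewrite ord1 /ball/=.
  have := hv i; have := hc i; rewrite /= mxE => h1 h2.
  rewrite (_ : _ - _ = (F w i 0 - ratr (c i)) - (v i 0 - ratr (c i))); last lra.
  by apply: le_lt_trans (ler_normB _ _) _; lra.
apply: countable_bigcupT_measurable => [|c]; first exact: countableP.
rewrite /Fb; case: asboolP => // _.
have -> : F @^-1` box c =
    \bigcap_(j in [set: 'I_n])
      ((fun w => `|F w j 0 - ratr (c.1 j 0)|) @^-1` `]-oo, (ratr c.2)[).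
  apply/seteqP; split => w /= h j; last by have := h j I; rewrite /= in_itv.
  by move=> _ /=; rewrite in_itv/=.
apply: fin_bigcap_measurable => [|j _]; first exact: finite_finset.
rewrite -[X in measurable X]setTI; apply: (_ : measurable_fun setT _) => //.
by apply: measurableT_comp => //; apply: measurable_funB => //; exact: mF.
Qed.
End borel.

(* [Omega] equipped with the sigma-algebra [sigma_gen D X]. *)
Notation past D X :=
  (g_sigma_algebraType (\bigcup_(i in D) preimage_set_system setT (X i) measurable)).

Section past.
Context (dO dT : measure_display) (Omega : measurableType dO)
  (T : measurableType dT) (I : eqType) (X : I -> Omega -> T).

Lemma sigma_gen_sub (D D' : set I) : D `<=` D' ->
  sigma_gen D X `<=` sigma_gen D' X.
Proof.
move=> DD'; apply: smallest_sub; first exact: smallest_sigma_algebra.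
by move=> A [i /DD' Di h]; apply: sub_sigma_algebra; exists i.
Qed.

Lemma sigma_gen_measurable (D : set I) :
  (forall i, D i -> measurable_fun setT (X i)) -> sigma_gen D X `<=` measurable.
Proof.
move=> mX; apply: smallest_sub; first exact: sigma_algebra_measurable.
by move=> _ [i Di [A mA <-]]; exact: mX.
Qed.

Context (d' : measure_display) (T' : measurableType d').

Lemma past_sub (D D' : set I) (f : Omega -> T') : D `<=` D' ->
  measurable_fun setT (f : past D X -> T') ->
  measurable_fun setT (f : past D' X -> T').
Proof. by move=> DD' mf _ A mA; apply: (sigma_gen_sub DD'); exact: mf. Qed.

Lemma past_measurable (D : set I) (f : Omega -> T') :
  (forall i, D i -> measurable_fun setT (X i)) ->
  measurable_fun setT (f : past D X -> T') -> measurable_fun setT f.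
Proof. by move=> mX mf _ A mA; apply: (sigma_gen_measurable mX); exact: mf. Qed.

Lemma past_gen (D : set I) i : D i ->
  measurable_fun setT (X i : past D X -> T).
Proof. by move=> Di _ A mA; apply: sub_sigma_algebra; exists i => //; exists A. Qed.

End past.

(** * Independence of the past and a fresh sample *)

Section independence.
Local Open Scope ereal_scope.
Context (R : realType) (dO dT : measure_display) (Omega : measurableType dO)
  (T : measurableType dT) (P : probability Omega R) (I : choiceType)
  (X : I -> Omega -> T) (D0 : set I).
Hypothesis indep : mutually_independent P D0 X.
Hypothesis mX : forall i, D0 i -> measurable_fun setT (X i).

(** Dynkin: the product formula holds on finite intersections of generators, by mutual independence,
    and passes to complements and countable disjoint unions, hence to the whole generated
    sigma-algebra. *)
Lemma indep_past (D : set I) p (E : set Omega) (B : set T) :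
  D `<=` D0 -> D0 p -> ~ D p -> sigma_gen D X E -> measurable B ->
  P (E `&` X p @^-1` B) = P E * P (X p @^-1` B).
Proof.
move=> DD0 D0p Dp sE mB.
have mXp : measurable (X p @^-1` B).
  by rewrite -[X in measurable X]setTI; exact: mX.
(* finite intersections of generators form a pi-system *)
pose G : set (set Omega) := [set E | exists (J : seq I) (A : I -> set T),
  [/\ uniq J, forall j, j \in J -> D j, forall j, measurable (A j) &
      E = \bigcap_(j in [set` J]) X j @^-1` A j]].
have mG : G `<=` measurable.
  move=> _ [J [A [_ JD mA ->]]]; apply: fin_bigcap_measurable => // j /= jJ.
  by rewrite -[X in measurable X]setTI; apply: mX => //; exact/DD0/JD.
have GI : setI_closed G.
  move=> _ _ [J [A [uJ JD mA ->]]] [K [C [uK KD mC ->]]].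
  (* An index absent from one list receives [setT] for it, so the merged list carries both
     constraints; [undup] because mutual independence asks for distinct indices. *)
  exists (undup (J ++ K)), (fun j => (if j \in J then A j else setT) `&`
    (if j \in K then C j else setT)); split.
  - exact: undup_uniq.
  - by move=> j; rewrite mem_undup mem_cat => /orP[/JD|/KD].
  - by move=> j; apply: measurableI; case: ifP.
  apply/seteqP; split=> [w [h1 h2] j /= jJK|w h].
    by split; case: ifP => // jj; [exact: h1|exact: h2].
  split=> j /= jJ; have /= := h j.
    by rewrite mem_undup mem_cat jJ => /(_ isT)[].
  by rewrite mem_undup mem_cat jJ orbT => /(_ isT)[].
have sG : sigma_gen D X = <<s G >>.
  apply/seteqP; split; apply: smallest_sub; try exact: smallest_sigma_algebra.
    move=> _ [i Di [A mA <-]]; apply: sub_sigma_algebra.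
    exists [:: i], (fun=> A); split => //.
      by move=> j; rewrite inE => /eqP ->.
    by rewrite setTI set_cons1 bigcap_set1.
  move=> _ [J [A [_ JD mA ->]]].
  apply: (@fin_bigcap_measurable _ (past D X)) => // j /= jJ.
  rewrite -[X in measurable X]setTI.
  by apply: (@past_gen _ _ Omega _ _ X D j (JD _ jJ)).
rewrite sG in sE.
pose Om' := g_sigma_algebraType G.
have mE (E' : set Om') : measurable E' -> measurable (E' : set Omega).
  by move: E'; apply: smallest_sub => //; exact: sigma_algebra_measurable.
pose Q (E : set Omega) := P (E `&` X p @^-1` B) = P E * P (X p @^-1` B).
have HC (S : set Omega) : measurable S -> Q S -> Q (~` S).
  move=> mS; rewrite /Q => IH.
  rewrite setIC -setDE measureD//; last by rewrite ltey_eq fin_num_measure.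
  rewrite (setIC _ S) [Y in _ - Y]IH probability_setC// muleBl ?fin_num_measure//.
  by rewrite mul1e.
have HU (F : (set Omega)^nat) : (forall n, measurable (F n)) ->
    trivIset setT F -> (forall n, Q (F n)) -> Q (\bigcup_k F k).
  rewrite /Q => mF tF IH.
  rewrite setI_bigcupl measure_bigcup//=; last 2 first.
    by move=> k _; exact: measurableI.
    by apply/trivIset_setIr.
  rewrite measure_bigcup//= muleC.
  have [r rE] : exists r : R, P (X p @^-1` B) = r%:E.
    by exists (fine (P (X p @^-1` B))); rewrite fineK// fin_num_measure.
  rewrite rE -nneseriesZl//; apply: eq_eseriesr => k _.
  by rewrite -rE muleC; exact: IH.
apply: (@dynkin_induction _ Om' G Q) sE => //.
- by rewrite /Q setTI probability_setT mul1e.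
- move=> _ [J [A [uJ JD mA ->]]].
  (* Since [p] is outside [D], the list [p :: J] is duplicate-free and mutual independence factors
     out the event of [X p]. *)
  have pJ : p \notin J by apply/negP => /JD.
  have := indep (J := p :: J) (A := fun j => if j == p then B else A j).
  rewrite /= pJ uJ big_cons eqxx => /(_ isT) h.
  have E1 : \bigcap_(j in [set` p :: J]) X j @^-1` (if j == p then B else A j) =
      (\bigcap_(j in [set` J]) X j @^-1` A j) `&` X p @^-1` B.
    have jp j : j \in J -> (j == p) = false.
      by move=> jJ; apply/negbTE; apply: contraNneq pJ => <-.
    apply/seteqP; split=> [w hw|w [h1 h2] j /=].
      split; last by have := hw p; rewrite /= eqxx inE eqxx; exact.
      by move=> j /= jJ; have := hw j; rewrite /= inE jJ orbT jp//; exact.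
    by rewrite inE => /predU1P[->|jJ]; rewrite ?eqxx// jp//; exact: h1.
  rewrite /Q -E1 h; last 2 first.
    by move=> j; rewrite inE => /predU1P[->//|/JD/DD0].
    by move=> j; case: ifP.
  rewrite muleC; congr (_ * _); rewrite (indep (A := A))//; last first.
    by move=> j /JD/DD0.
  apply: eq_big_seq => j jJ; case: eqP => // jp.
  by move: pJ; rewrite -jp jJ.
- by move=> S /mE; exact: HC.
- by move=> F mF; apply: HU => n; exact/mE.
Qed.

End independence.

(** * Freezing one of two independent variables *)

Section freezing.
Local Open Scope ereal_scope.
Context (R : realType) (d0 d1 d2 : measure_display) (Omega : measurableType d0)
  (T1 : measurableType d1) (T2 : measurableType d2) (P : probability Omega R)
  (X : Omega -> T1) (Y : Omega -> T2).
Hypotheses (mX : measurable_fun setT X) (mY : measurable_fun setT Y).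
Hypothesis indep : forall A B, measurable A -> measurable B ->
  P (X @^-1` A `&` Y @^-1` B) = P (X @^-1` A) * P (Y @^-1` B).

HB.instance Definition _ := isMeasurableFun.Build _ _ _ _ X mX.
HB.instance Definition _ := isMeasurableFun.Build _ _ _ _ Y mY.

Let XY w := (X w, Y w).
Let mXY : measurable_fun setT XY. Proof. exact: measurable_fun_pair. Qed.
HB.instance Definition _ := isMeasurableFun.Build _ _ _ _ XY mXY.

Let joint (A : set (T1 * T2)) : measurable A ->
  (distribution P X \x distribution P Y) A = distribution P XY A.
Proof.
apply: product_measure_unique => B C mB mC.
by rewrite /distribution /pushforward/= -indep.
Qed.

(** By independence the law of the pair is the product of the two laws ([joint]); Tonelli iterates
    the integral, and each law is pulled back to [P]. *)
Lemma ge0_freezing (phi : T1 * T2 -> \bar R) : measurable_fun setT phi ->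
  (forall z, 0 <= phi z) ->
  \int[P]_w phi (X w, Y w) = \int[P]_w \int[P]_w' phi (X w, Y w').
Proof.
move=> mphi phi0.
rewrite -(@ge0_integral_distribution _ _ _ _ _ P XY)//.
transitivity (\int[distribution P X \x distribution P Y]_z phi z).
  by apply: eq_measure_integral => A mA _; exact: (esym (joint mA)).
rewrite fubini_tonelli1// /fubini_F.
rewrite ge0_integral_distribution//; last 2 first.
- exact: measurable_fun_fubini_tonelli_F.
- by move=> x; exact: integral_ge0.
apply: eq_integral => w _ /=.
rewrite ge0_integral_distribution//.
exact: measurable_fun_pair2.
Qed.

Lemma measurable_freezing (phi : T1 * T2 -> \bar R) : measurable_fun setT phi ->
  (forall z, 0 <= phi z) ->
  measurable_fun setT (fun w => \int[P]_w' phi (X w, Y w')).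
Proof.
move=> mphi phi0.
rewrite (_ : (fun w => _) = fubini_F (distribution P Y) phi \o X).
  apply: measurableT_comp => //.
  exact: measurable_fun_fubini_tonelli_F.
apply/funext => w; rewrite /fubini_F/= ge0_integral_distribution//.
exact: measurable_fun_pair2.
Qed.

(** Positive and negative parts are frozen separately. Their inner integrals agree almost surely, so
    the two outer integrals are equal; integrability makes them finite, and their difference is
    0. *)
Lemma freezing_eq0 (phi : T1 * T2 -> \bar R) : measurable_fun setT phi ->
  P.-integrable setT (fun w => phi (X w, Y w)) ->
  {ae P, forall w, \int[P]_w' phi (X w, Y w') = 0} ->
  \int[P]_w phi (X w, Y w) = 0.
Proof.
move=> mphi iphi phi0.
have pos_neg : \int[P]_w phi^\+ (X w, Y w) = \int[P]_w phi^\- (X w, Y w).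
  rewrite !ge0_freezing//; last 2 first.
  - exact: measurable_funeneg.
  - exact: measurable_funepos.
  apply: ae_eq_integral => //.
  - by apply: measurable_freezing => //; exact: measurable_funepos.
  - by apply: measurable_freezing => //; exact: measurable_funeneg.
  apply: filterS phi0 => w + _.
  rewrite -[Z in integral P setT Z = _]/(phi \o (fun w' => (X w, Y w'))).
  rewrite integralE funepos_comp funeneg_comp.
  set a := integral _ _ _; set b := integral _ _ _ => /eqP ab0.
  have a0 : 0 <= a by apply: integral_ge0 => z _; exact: funepos_ge0.
  have b0 : 0 <= b by apply: integral_ge0 => z _; exact: funeneg_ge0.
  suff : a = b by [].
  by case: (a) (b) a0 b0 ab0 => [r| |] [s| |]//= _ _; rewrite ?eqe ?subr_eq0 => /eqP ->.
rewrite -[Z in integral P setT Z = _]/(phi \o XY).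
rewrite integralE funepos_comp funeneg_comp.
rewrite -[Z in Z - _]/(\int[P]_w phi^\+ (X w, Y w)).
rewrite -[Z in _ - Z]/(\int[P]_w phi^\- (X w, Y w)) pos_neg.
rewrite subee// -[integral _ _ _]/(\int[P]_w (phi^\- \o XY) w).
by rewrite -funeneg_comp; apply: integrable_neg_fin_num.
Qed.

End freezing.

(** * Stochastic gradient noise *)

Section measurable_vec.
Context (R : realType) (n : nat) (d : measure_display) (T : measurableType d).
Implicit Types (F G : T -> borel 'cV[R]_n).

Lemma measurable_coordT F (j : 'I_n) : measurable_fun setT F ->
  measurable_fun setT (fun w => F w j 0).
Proof. by move=> mF; exact: (measurableT_comp (measurable_coord j) mF). Qed.

Lemma measurable_addV F G : measurable_fun setT F -> measurable_fun setT G ->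
  measurable_fun setT ((fun w => F w + G w) : T -> borel 'cV[R]_n).
Proof.
move=> mF mG; apply: measurable_fun_coords => j; under eq_fun do rewrite mxE.
by apply: measurable_funD; exact: measurable_coordT.
Qed.

(** Measurability of the scalar is requested only when an index exists: in dimension 0 the matrices
    of AS.4 are empty and say nothing about [lambda]. *)
Lemma measurable_scaleV (a : T -> R) F :
  ('I_n -> measurable_fun setT a) -> measurable_fun setT F ->
  measurable_fun setT ((fun w => a w *: (F w : 'cV[R]_n)) : T -> borel 'cV[R]_n).
Proof.
move=> ma mF; apply: measurable_fun_coords => j; under eq_fun do rewrite mxE.
by apply: measurable_funM; [exact: ma|exact: measurable_coordT].
Qed.

Lemma measurable_subV F G : measurable_fun setT F -> measurable_fun setT G ->
  measurable_fun setT ((fun w => F w - G w) : T -> borel 'cV[R]_n).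
Proof.
move=> mF mG; apply: measurable_fun_coords => j; under eq_fun do rewrite !mxE.
by apply: measurable_funB; exact: measurable_coordT.
Qed.

Lemma measurable_sumV (I : eqType) (s : seq I) (F : I -> T -> borel 'cV[R]_n) :
  (forall i, i \in s -> measurable_fun setT (F i)) ->
  measurable_fun setT ((fun w => \sum_(i <- s) F i w) : T -> borel 'cV[R]_n).
Proof.
elim: s => [|i s IH] mF.
  by under eq_fun do rewrite big_nil; exact: measurable_cst.
under eq_fun do rewrite big_cons.
apply: measurable_addV; first by apply: mF; rewrite mem_head.
by apply: IH => j js; apply: mF; rewrite inE js orbT.
Qed.

Lemma measurable_dotv F G : measurable_fun setT F -> measurable_fun setT G ->
  measurable_fun setT (fun w => dotv (F w : 'cV[R]_n) (G w)).
Proof.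
move=> mF mG; apply: measurable_sum => j.
by apply: measurable_funM; exact: measurable_coordT.
Qed.

End measurable_vec.

Lemma coordB (R : zmodType) n (u v : 'cV[R]_n) j : (u - v) j 0 = u j 0 - v j 0.
Proof. by rewrite !mxE. Qed.

Section L1.
Context (R : realType) (d : measure_display) (T : measurableType d)
  (P : probability T R).
Implicit Types f g : T -> R.

Lemma L1_measurable f : P.-integrable setT (EFin \o f) -> measurable_fun setT f.
Proof. by move/measurable_int/measurable_EFinP. Qed.

Lemma L1_le f g : measurable_fun setT f -> (forall w, `|f w| <= g w) ->
  P.-integrable setT (EFin \o g) -> P.-integrable setT (EFin \o f).
Proof.
move=> mf fg; apply: le_integrable => //; first exact/measurable_EFinP.
by move=> w _ /=; rewrite lee_fin (le_trans (fg w))// ler_norm.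
Qed.

Lemma L1D f g : P.-integrable setT (EFin \o f) -> P.-integrable setT (EFin \o g) ->
  P.-integrable setT (EFin \o (fun w => f w + g w)).
Proof. exact: integrableD. Qed.

Lemma L1Z a f : P.-integrable setT (EFin \o f) ->
  P.-integrable setT (EFin \o (fun w => a * f w)).
Proof. exact: integrableZl. Qed.

(** If the positive or the negative part had an infinite integral, the difference would be infinite
    too. This extracts integrability of the samples from the finite means in AS.2. *)
Lemma L1_of_integral f r : measurable_fun setT f ->
  (\int[P]_w (f w)%:E = r%:E)%E -> P.-integrable setT (EFin \o f).
Proof.
move=> mf; rewrite -[integral _ _ _]/(integral P setT (EFin \o f)) integralE => ifr.
have mf' : measurable_fun setT (EFin \o f) by exact/measurable_EFinP.
apply/integrableP; split => //.
rewrite (_ : (fun x => _) = fun x => ((EFin \o f)^\+ x + (EFin \o f)^\- x)%E); last first.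
  by apply/funext => x; rewrite -[LHS]/((abse \o (EFin \o f)) x) fune_abse.
rewrite ge0_integralD//; last 2 first.
  exact: measurable_funepos.
  exact: measurable_funeneg.
have : (0 <= \int[P]_x (EFin \o f)^\- x)%E.
  by apply: integral_ge0 => z _; exact: funeneg_ge0.
have : (0 <= \int[P]_x (EFin \o f)^\+ x)%E.
  by apply: integral_ge0 => z _; exact: funepos_ge0.
move: ifr; set a := (\int[P]_x ((EFin \o f)^\+ x))%E.
set b := (\int[P]_x ((EFin \o f)^\- x))%E.
by case: a b => [?| |] [?| |]//=; rewrite ltry.
Qed.

End L1.

Section sample.
Context (R : realType) (n d : nat) (f : 'cV[R]_n -> R)
  (G : 'cV[R]_n -> 'cV[R]_d -> 'cV[R]_n) (sigma : R).
Hypothesis cg : continuous (grad f).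
Hypothesis mG : measurable_fun setT (fun p : borel 'cV[R]_n * borel 'cV[R]_d =>
    G p.1 p.2 : borel 'cV[R]_n).

Lemma measurable_noise d0 (T : measurableType d0) (x : T -> borel 'cV[R]_n)
    (y : T -> borel 'cV[R]_d) : measurable_fun setT x -> measurable_fun setT y ->
  measurable_fun setT ((fun w => G (x w) (y w) - grad f (x w)) : T -> borel 'cV[R]_n).
Proof.
move=> mx my; apply: measurable_subV.
  exact: (measurableT_comp mG (measurable_fun_pair mx my)).
exact: (measurableT_comp (continuous_measurable_borelV cg) mx).
Qed.

Context (dO : measure_display) (Omega : measurableType dO)
  (P : probability Omega R) (I : choiceType) (xi : I -> Omega -> 'cV[R]_d)
  (D0 : set I).
Hypothesis indep : mutually_independent P D0 (xi : _ -> Omega -> borel 'cV[R]_d).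
Hypothesis mxi : forall p, D0 p ->
  measurable_fun setT (xi p : Omega -> borel 'cV[R]_d).
Context (D : set I) (p : I) (x : Omega -> 'cV[R]_n).
Hypotheses (DD0 : D `<=` D0) (D0p : D0 p) (Dp : ~ D p).
Hypothesis mx : measurable_fun setT
  (x : past D (xi : _ -> Omega -> borel 'cV[R]_d) -> borel 'cV[R]_n).
Hypothesis mean : {ae P, forall w, forall j : 'I_n,
  'E_P[(fun w' => G (x w) (xi p w') j 0)%R]%E = (grad f (x w) j 0)%:E}.
Hypothesis var : {ae P, forall w,
  ('E_P[(fun w' => enorm (G (x w) (xi p w') - grad f (x w)) ^+ 2)%R]
    <= (sigma ^+ 2)%:E)%E}.

Let delta w := G (x w) (xi p w) - grad f (x w).

Let mxO : measurable_fun setT (x : Omega -> borel 'cV[R]_n).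
Proof.
by apply: (past_measurable _ mx) => i /DD0; exact: mxi.
Qed.

Let mg : measurable_fun setT (grad f : borel 'cV[R]_n -> borel 'cV[R]_n).
Proof. exact: continuous_measurable_borelV. Qed.

Lemma measurable_sample_noise : measurable_fun setT (delta : Omega -> borel 'cV[R]_n).
Proof. exact: (measurable_noise mxO (mxi D0p)). Qed.

Lemma past_indep dT (T : measurableType dT) (Z : Omega -> T) :
  measurable_fun setT (Z : past D (xi : _ -> Omega -> borel 'cV[R]_d) -> T) ->
  forall A B, measurable A -> measurable B ->
  (P (Z @^-1` A `&` (xi p : _ -> borel 'cV[R]_d) @^-1` B) =
   P (Z @^-1` A) * P ((xi p : _ -> borel 'cV[R]_d) @^-1` B))%E.
Proof.
move=> mZ A B mA mB; apply: (indep_past indep mxi DD0) => //.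
by rewrite -[Z @^-1` A]setTI; exact: mZ.
Qed.

(** Once [x] is frozen, the inner integral is the one that AS.2 bounds almost surely. *)
Lemma noise_var : (\int[P]_w (dotv (delta w) (delta w))%:E <= (sigma ^+ 2)%:E)%E.
Proof.
pose phi (z : borel 'cV[R]_n * borel 'cV[R]_d) : \bar R :=
  (dotv (G z.1 z.2 - grad f z.1) (G z.1 z.2 - grad f z.1))%:E.
have mphi : measurable_fun setT phi.
  apply/measurable_EFinP; apply: measurable_dotv; apply: measurable_subV => //;
  exact: (measurableT_comp mg).
have := ge0_freezing mxO (mxi D0p) (past_indep mx) mphi.
rewrite /phi/= => ->; last by move=> z; rewrite lee_fin dotv_ge0.
rewrite -[leRHS]mule1 -(@probability_setT _ _ _ P) -integral_cst//.
apply: ae_ge0_le_integral => //.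
- by move=> w _; apply: integral_ge0 => w' _; rewrite lee_fin dotv_ge0.
- have := measurable_freezing P mxO (mxi D0p) mphi; apply => z.
  by rewrite lee_fin dotv_ge0.
- by move=> w _; rewrite lee_fin sqr_ge0.
apply: filterS var => w + _; rewrite unlock; apply: le_trans.
by under [leRHS]eq_integral do rewrite sqr_enorm.
Qed.

Lemma noise_L2 : P.-integrable setT (EFin \o (fun w => dotv (delta w) (delta w))).
Proof.
apply/integrableP; split.
  by apply/measurable_EFinP; apply: measurable_dotv; exact: measurable_sample_noise.
under eq_integral do rewrite /= ger0_norm ?dotv_ge0//.
exact: le_lt_trans noise_var (ltry _).
Qed.

Lemma dotv_L1 (U V : Omega -> 'cV[R]_n) :
  measurable_fun setT (U : Omega -> borel 'cV[R]_n) ->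
  measurable_fun setT (V : Omega -> borel 'cV[R]_n) ->
  P.-integrable setT (EFin \o (fun w => dotv (U w) (U w))) ->
  P.-integrable setT (EFin \o (fun w => dotv (V w) (V w))) ->
  P.-integrable setT (EFin \o (fun w => dotv (U w) (V w))).
Proof.
move=> mU mV U2 V2; apply: L1_le (L1D U2 V2); first exact: measurable_dotv.
(* Nonnegativity of [|U + V|^2] and [|U - V|^2] bounds [2 dotv U V] on both sides by
   [|U|^2 + |V|^2]. *)
move=> w; have := dotv_ge0 (U w - V w); have := dotv_ge0 (U w + V w).
rewrite !dotvDl !dotvDr !dotvNl !dotvNr (dotvC (V w) (U w)).
have := dotv_ge0 (U w); have := dotv_ge0 (V w).
by move=> *; rewrite ler_norml; apply/andP; split; lra.
Qed.

Context (V : Omega -> 'cV[R]_n).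
Hypothesis mV : measurable_fun setT
  (V : past D (xi : _ -> Omega -> borel 'cV[R]_d) -> borel 'cV[R]_n).
Hypothesis V2 : P.-integrable setT (EFin \o (fun w => dotv (V w) (V w))).

Let mVO : measurable_fun setT (V : Omega -> borel 'cV[R]_n).
Proof.
by apply: (past_measurable _ mV) => i /DD0; exact: mxi.
Qed.

Lemma noise_L1 : P.-integrable setT (EFin \o (fun w => dotv (V w) (delta w))).
Proof. by apply: dotv_L1 => //; [exact: measurable_sample_noise|exact: noise_L2]. Qed.

(** The pair [(x, V)] is frozen jointly, as [V] need not be a function of [x]. The inner integral is
    then linear in the coordinates of the noise, each of mean zero by AS.2. *)
Lemma noise_orthogonal : (\int[P]_w (dotv (V w) (delta w))%:E = 0)%E.
Proof.
pose phi (z : (borel 'cV[R]_n * borel 'cV[R]_n) * borel 'cV[R]_d) : \bar R :=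
  (dotv (z.1.2 : 'cV[R]_n) (G z.1.1 z.2 - grad f z.1.1))%:E.
have m11 : measurable_fun setT
    (fun z : (borel 'cV[R]_n * borel 'cV[R]_n) * borel 'cV[R]_d => z.1.1).
  exact: measurableT_comp.
have mphi : measurable_fun setT phi.
  apply/measurable_EFinP; apply: measurable_dotv; first exact: measurableT_comp.
  apply: measurable_subV => //; last exact: (measurableT_comp mg).
  apply: (measurableT_comp mG (_ : measurable_fun _ (fun z => (z.1.1, z.2)))) => //.
  exact: measurable_fun_pair.
have := freezing_eq0 (measurable_fun_pair mxO mVO) (mxi D0p)
  (past_indep (measurable_fun_pair mx mV)) mphi.
apply; first exact: noise_L1.
apply: filterS mean => w; rewrite unlock /phi/= => mw.
have mGj (j : 'I_n) : measurable_fun setT (fun w' => G (x w) (xi p w') j 0).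
  apply: measurable_coordT.
  apply: (measurableT_comp (measurable_fun_pair2 _ mG)); exact: mxi.
have iGj (j : 'I_n) : P.-integrable setT (EFin \o (fun w' => G (x w) (xi p w') j 0)).
  exact: (L1_of_integral (mGj j) (mw j)).
have iDj (j : 'I_n) : P.-integrable setT
    (EFin \o (fun w' => G (x w) (xi p w') j 0 - grad f (x w) j 0)).
  apply: (@L1D _ _ _ _ _ (cst (- grad f (x w) j 0))) => //.
  exact: finite_measure_integrable_cst.
under eq_integral do rewrite /dotv -sumEFin.
rewrite integral_sum//; last first.
  by move=> j; under eq_fun do rewrite coordB; exact: (L1Z _ (iDj j)).
apply: big1 => j _; under eq_integral do rewrite coordB EFinM.
rewrite integralZl//; last exact: (iDj j).
have -> : (\int[P]_w' (G (x w) (xi p w') j 0 - grad f (x w) j 0)%:E = 0)%E.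
  under eq_integral do rewrite EFinB.
  rewrite integralB_EFin//; last exact: finite_measure_integrable_cst.
  have := expectation_cst P (grad f (x w) j 0); rewrite unlock => eg.
  by rewrite mw [Z in (_ - Z)%E]eg subee.
by rewrite mule0.
Qed.

End sample.

(** * Noise of a whole minibatch *)

Section minibatch.
Context (R : realType) (n d : nat) (f : 'cV[R]_n -> R)
  (G : 'cV[R]_n -> 'cV[R]_d -> 'cV[R]_n) (sigma : R).
Hypothesis cg : continuous (grad f).
Hypothesis mG : measurable_fun setT (fun p : borel 'cV[R]_n * borel 'cV[R]_d =>
    G p.1 p.2 : borel 'cV[R]_n).

Context (dO : measure_display) (Omega : measurableType dO)
  (P : probability Omega R) (xi : nat * nat -> Omega -> 'cV[R]_d)
  (N : nat) (ms : nat -> nat).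
Local Notation past_xi D := (past D (xi : _ -> Omega -> borel 'cV[R]_d)).
Lemma measurable_minibatch k (x : Omega -> 'cV[R]_n) : (0 < k)%N ->
  measurable_fun setT (x : past_xi (sample_idx ms k.-1) -> borel 'cV[R]_n) ->
  measurable_fun setT ((fun w => minibatch G ms xi k (x w) w) :
    past_xi (sample_idx ms k) -> borel 'cV[R]_n).
Proof.
move=> k0 mx.
have sub : sample_idx ms k.-1 `<=` sample_idx ms k.
  by move=> [a c]; rewrite /sample_idx/=; lia.
have mxk := past_sub sub mx.
apply: (@measurable_scaleV R n _ (past_xi (sample_idx ms k)) (cst (ms k)%:R^-1)).
  by move=> _; exact: measurable_cst.
apply: (@measurable_sumV R n _ (past_xi (sample_idx ms k)) _ _
  (fun i w => G (x w) (xi (k, i) w))) => j.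
rewrite mem_index_iota ltnS => ji.
apply: (measurableT_comp mG (measurable_fun_pair mxk _)).
by apply: past_gen; rewrite /sample_idx/=; lia.
Qed.

Hypothesis indep : mutually_independent P (sample_idx ms N)
  (xi : _ -> Omega -> borel 'cV[R]_d).
Hypothesis mxi : forall p, sample_idx ms N p ->
  measurable_fun setT (xi p : Omega -> borel 'cV[R]_d).
Context (k : nat) (x : Omega -> 'cV[R]_n).
Hypotheses (kN : (1 <= k <= N)%N) (ms0 : (0 < ms k)%N).
Hypothesis mx : measurable_fun setT
  (x : past_xi (sample_idx ms k.-1) -> borel 'cV[R]_n).
Hypothesis mean : forall i, sample_idx ms N (k, i) ->
  {ae P, forall w, forall j : 'I_n,
  'E_P[(fun w' => G (x w) (xi (k, i) w') j 0)%R]%E = (grad f (x w) j 0)%:E}.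
Hypothesis var : forall i, sample_idx ms N (k, i) -> {ae P, forall w,
  ('E_P[(fun w' => enorm (G (x w) (xi (k, i) w') - grad f (x w)) ^+ 2)%R]
    <= (sigma ^+ 2)%:E)%E}.

Let delta i w := G (x w) (xi (k, i) w) - grad f (x w).

(** The samples already drawn when [(k, i.+1)] is drawn. Refining the past inside iteration [k]
    makes the partial sum [S i] part of it. *)
Let D i : set (nat * nat) :=
  sample_idx ms k.-1 `|` [set p | p.1 = k /\ (1 <= p.2 <= i)%N].

Let D0k i : (1 <= i <= ms k)%N -> sample_idx ms N (k, i).
Proof. by move=> h; rewrite /sample_idx/= kN. Qed.

Let DD0 i : (i <= ms k)%N -> D i `<=` sample_idx ms N.
Proof.
move=> ib [a c] [|[]]; rewrite /sample_idx/=.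
  by case/andP => h1 h2; apply/andP; split; lia.
by move=> -> h; lia.
Qed.

Let notD i : ~ D i (k, i.+1).
Proof. by move=> []; rewrite /sample_idx/=; [lia|case; lia]. Qed.

Let D_past i : sample_idx ms k.-1 `<=` D i.
Proof. exact: subsetUl. Qed.

Let mxD i : measurable_fun setT (x : past_xi (D i) -> borel 'cV[R]_n).
Proof. exact: (past_sub (@D_past i) mx). Qed.

Let S i w := \sum_(1 <= j < i.+1) delta j w.

Let mS i : measurable_fun setT (S i : past_xi (D i) -> borel 'cV[R]_n).
Proof.
apply: (@measurable_sumV R n _ (past_xi (D i)) _ _ delta) => j.
rewrite mem_index_iota ltnS => ji.
apply: (@measurable_noise _ _ _ _ _ cg mG _ (past_xi (D i)) x (xi (k, j))); first exact: mxD.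
by apply: past_gen; right.
Qed.

(** Orthogonal increments: expanding [|S i + delta i.+1|^2], the cross term integrates to 0 because
    [S i] belongs to the past [D i], so the variances add. *)
Let S_bound i : (i <= ms k)%N ->
  P.-integrable setT (EFin \o (fun w => dotv (S i w) (S i w))) /\
  (\int[P]_w (dotv (S i w) (S i w))%:E <= (i%:R * sigma ^+ 2)%:E)%E.
Proof.
elim: i => [_|i IH ib].
  have S0 w : dotv (S 0 w) (S 0 w) = 0.
    by rewrite /S big_geq// -(scale0r 0) dotvZl mul0r.
  under [X in integrable _ _ (_ \o X)]eq_fun do rewrite S0.
  split; first exact: finite_measure_integrable_cst.
  by under eq_integral do rewrite S0; rewrite integral0 mul0r.
have {IH}[S2 Sb] := IH (ltnW ib).
have D0i : sample_idx ms N (k, i.+1) by exact: D0k.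
have dL2 := noise_L2 cg mG indep mxi (DD0 (ltnW ib)) D0i (@notD i) (@mxD i) (var D0i).
have dvar := noise_var cg mG indep mxi (DD0 (ltnW ib)) D0i (@notD i) (@mxD i) (var D0i).
have dL1 := noise_L1 cg mG indep mxi (DD0 (ltnW ib)) D0i (@notD i) (@mxD i) (var D0i)
  (@mS i) S2.
have orth := noise_orthogonal cg mG indep mxi (DD0 (ltnW ib)) D0i (@notD i) (@mxD i)
  (mean D0i) (var D0i) (@mS i) S2.
have E w : dotv (S i.+1 w) (S i.+1 w) = dotv (S i w) (S i w) +
    (2 * dotv (S i w) (delta i.+1 w) + dotv (delta i.+1 w) (delta i.+1 w)).
  have -> : S i.+1 w = S i w + delta i.+1 w by rewrite /S big_nat_recr.
  move: (S i w) (delta i.+1 w) => u v.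
  by rewrite !dotvDl !dotvDr (dotvC v u); ring.
have I2 := L1D (L1Z 2 dL1) dL2.
split.
  under [X in integrable _ _ (_ \o X)]eq_fun do rewrite E.
  exact: L1D.
under eq_integral do rewrite E EFinD.
rewrite integralD//; under [X in (_ + X <= _)%E]eq_integral do rewrite EFinD.
rewrite integralD//; last exact: (L1Z 2 dL1).
under [X in (_ + (X + _) <= _)%E]eq_integral do rewrite EFinM.
rewrite integralZl// orth mule0 add0e.
rewrite -natr1 mulrDl mul1r EFinD.
by apply: leeD.
Qed.

Definition batch_noise w := minibatch G ms xi k (x w) w - grad f (x w).

Let batch_noiseE w : batch_noise w = (ms k)%:R^-1 *: S (ms k) w.
Proof.
have -> : S (ms k) w = \sum_(1 <= i < (ms k).+1) G (x w) (xi (k, i) w) -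
    (ms k)%:R *: grad f (x w).
  by rewrite /S /delta sumrB sumr_const_nat subSS subn0 scaler_nat.
rewrite scalerBr scalerA mulVf ?scale1r//.
by rewrite pnatr_eq0 -lt0n.
Qed.

Lemma batch_noise_L2 :
  P.-integrable setT (EFin \o (fun w => dotv (batch_noise w) (batch_noise w))).
Proof.
under [X in integrable _ _ (_ \o X)]eq_fun do
  rewrite batch_noiseE dotvZl dotvZr mulrA.
exact: L1Z (S_bound (leqnn _)).1.
Qed.

Lemma batch_noise_var :
  (\int[P]_w (dotv (batch_noise w) (batch_noise w))%:E <= (sigma ^+ 2 / (ms k)%:R)%:E)%E.
Proof.
under eq_integral do rewrite batch_noiseE dotvZl dotvZr mulrA EFinM.
have b0 : (ms k)%:R != 0 :> R by rewrite pnatr_eq0 -lt0n.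
rewrite integralZl//; last exact: (S_bound (leqnn _)).1.
have -> : sigma ^+ 2 / (ms k)%:R =
    ((ms k)%:R^-1 * (ms k)%:R^-1) * ((ms k)%:R * sigma ^+ 2).
  by field.
rewrite [X in (_ <= X)%E]EFinM lee_wpmul2l//; last exact: (S_bound (leqnn _)).2.
Qed.

Context (V : Omega -> 'cV[R]_n).
Hypothesis mV : measurable_fun setT
  (V : past_xi (sample_idx ms k.-1) -> borel 'cV[R]_n).
Hypothesis V2 : P.-integrable setT (EFin \o (fun w => dotv (V w) (V w))).

Let sub0 : sample_idx ms k.-1 `<=` sample_idx ms N.
Proof. by apply: subset_trans (@D_past 0) _; exact: DD0. Qed.

Let not0 i : ~ sample_idx ms k.-1 (k, i).
Proof. by rewrite /sample_idx/=; lia. Qed.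

Lemma batch_noise_orthogonal :
  P.-integrable setT (EFin \o (fun w => dotv (V w) (batch_noise w))) /\
  (\int[P]_w (dotv (V w) (batch_noise w))%:E = 0)%E.
Proof.
have E w : dotv (V w) (batch_noise w) =
    (ms k)%:R^-1 * \sum_(i <- index_iota 1 (ms k).+1) dotv (V w) (delta i w).
  by rewrite batch_noiseE dotvZr /S dotv_sumr.
have H i : (1 <= i < (ms k).+1)%N ->
    P.-integrable setT (EFin \o (fun w => dotv (V w) (delta i w))) /\
    (\int[P]_w (dotv (V w) (delta i w))%:E = 0)%E.
  move=> ib; have D0i : sample_idx ms N (k, i) by exact: D0k.
  split.
    exact: (noise_L1 cg mG indep mxi sub0 D0i (@not0 i) mx (var D0i) mV V2).
  exact: (noise_orthogonal cg mG indep mxi sub0 D0i (@not0 i) mx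
    (mean D0i) (var D0i) mV V2).
have {}H s : {subset s <= index_iota 1 (ms k).+1} ->
    P.-integrable setT (EFin \o (fun w => \sum_(i <- s) dotv (V w) (delta i w))) /\
    (\int[P]_w (\sum_(i <- s) dotv (V w) (delta i w))%:E = 0)%E.
  elim: s => [_|i s IH sub].
    under [X in integrable _ _ (_ \o X)]eq_fun do rewrite big_nil.
    split; first exact: finite_measure_integrable_cst.
    by under eq_integral do rewrite big_nil; rewrite integral0.
  have [|I1 I2] := IH; first by move=> j js; apply: sub; rewrite inE js orbT.
  have [|J1 J2] := H i; first by rewrite -mem_index_iota sub ?mem_head.
  split.
    under [X in integrable _ _ (_ \o X)]eq_fun do rewrite big_cons.
    exact: L1D.
  under eq_integral do rewrite big_cons EFinD.
  by rewrite integralD// I2 J2 adde0.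
have [I1 I2] := H _ (fun _ => id).
split.
  under [X in integrable _ _ (_ \o X)]eq_fun do rewrite E.
  exact: L1Z.
under eq_integral do rewrite E EFinM.
by rewrite integralZl// I2 mule0.
Qed.

End minibatch.

(** * Iterates of the method *)

(** Needed to recover [lambda k] as the inverse of a diagonal entry of [B_k]. The inverse is
    continuous off 0, and the point 0 is a separate measurable piece. *)
Lemma measurable_invr (R : realType) : measurable_fun setT (@GRing.inv R).
Proof.
have -> : [set: R] = [set t | t != 0] `|` [set 0].
  by apply/seteqP; split => t //= _; case: (eqVneq t 0) => [->|]; [right|left].
have m0 : measurable [set t : R | t != 0].
  rewrite (_ : [set _ | _] = ~` [set 0]); first exact: measurableC.
  by apply/seteqP; split => t /= /eqP.
apply/measurable_funU => //; split; last exact: measurable_fun_set1.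
apply: open_continuous_measurable_fun; first exact: open_neq.
by move=> t; rewrite inE/= => t0; exact: inv_continuous.
Qed.

Lemma measurable_diag (R : realType) n (j : 'I_n) :
  measurable_fun setT ((fun B => B j j) : borel 'M[R]_n -> R).
Proof.
apply: (measurability _ (RGenOpens.measurableE R)).
move=> _ [_ [a [b ->] <-]]; rewrite setTI; apply: sub_sigma_algebra.
have /continuousP := @coord_continuous R n n j j.
by apply; exact: interval_open.
Qed.

Lemma loewner_le_scalar (R : realType) n (j : 'I_n) (a b : R) :
  loewner_le (a%:M : 'M[R]_n) b%:M -> a <= b.
Proof.
move=> [_ /(_ (delta_mx j 0))]; rewrite -raddfB mul_mx_scalar -scalemxAl.
by rewrite trmx_delta mul_delta_mx !mxE !eqxx mulr1 subr_ge0.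
Qed.

Lemma invmx_Bmx (R : realType) n (Omega : Type) (lambda : nat -> Omega -> R) k w
    (z : R) :
  invmx (Bmx n lambda k w) + z%:M = (lambda k w + z)%:M.
Proof. by rewrite /Bmx invmx_scalar invrK raddfD. Qed.

Section iteration.
Context (R : realType) (n d : nat)
    (f : 'cV[R]_n -> R) (flow L : R)
    (G : 'cV[R]_n -> 'cV[R]_d -> 'cV[R]_n) (sigma : R)
    (x1 : 'cV[R]_n) (lambda1 lmin lmax : R) (q : nat) (m M : R).
Hypotheses (L0 : 0 < L) (m0 : 0 < m) (M0 : 0 < M).
Hypothesis as1 : AS1 f flow L.
Hypothesis mG : measurable_fun setT (fun p : borel 'cV[R]_n * borel 'cV[R]_d =>
    G p.1 p.2 : borel 'cV[R]_n).
Context (b N : nat) (dO : measure_display) (Omega : measurableType dO)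
    (P : probability Omega R) (zeta : nat -> R)
    (xi : nat * nat -> Omega -> 'cV[R]_d)
    (x : nat -> Omega -> 'cV[R]_n) (lambda : nat -> Omega -> R).
Local Notation ms := (fun _ : nat => b).
Local Notation alpha := (m / (L * M ^+ 2)).
Local Notation past_xi D := (past D (xi : _ -> Omega -> borel 'cV[R]_d)).
Hypothesis b0 : (0 < b)%N.
Hypothesis mxi : forall p, sample_idx ms N p ->
  measurable_fun setT (xi p : Omega -> borel 'cV[R]_d).
Hypothesis rsqn : rsqn_scbb G x1 lambda1 lmin lmax q N ms (fun=> alpha) zeta xi x lambda.
Hypothesis as2 : AS2 f G sigma P N ms xi x.
Hypothesis as3 : AS3 m M P N zeta (Bmx n lambda).
Hypothesis as4 : AS4 N ms xi (Bmx n lambda).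

Let h k w := lambda k w + zeta k.

Let stepE k w : (1 <= k <= N)%N ->
  x k.+1 w = x k w - (alpha * h k w) *: minibatch G ms xi k (x k w) w.
Proof.
by move=> kN; rewrite (rsqn_step rsqn)// invmx_Bmx mul_scalar_mx scalerA.
Qed.

(** AS.4 speaks of [B_k] for [k >= 2], so [lambda k] is read off the diagonal entry at [j];
    [lambda 1] is constant. *)
Let mh k (j : 'I_n) : (1 <= k <= N)%N ->
  measurable_fun setT (h k : past_xi (sample_idx ms k.-1) -> R).
Proof.
move=> kN; apply: measurable_funD; last exact: measurable_cst.
have [k1|k1] := leqP k 1.
  have -> : k = 1%N by lia.
  rewrite (_ : lambda 1%N = cst lambda1); last first.
    by apply/funext => w; exact: (scbb_init rsqn).
  exact: measurable_cst.
have mB : measurable_fun setT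
    (Bmx n lambda k : past_xi (sample_idx ms k.-1) -> borel 'M[R]_n).
  by move=> _ A mA; rewrite setTI; apply: (as4 _ mA); lia.
rewrite (_ : lambda k = (fun w => ((Bmx n lambda k w) j j)^-1)).
  exact: (measurableT_comp (@measurable_invr R)
    (measurableT_comp (measurable_diag j) mB)).
by apply/funext => w; rewrite mxE eqxx mulr1n invrK.
Qed.

Let sub_past k : sample_idx ms k.-1 `<=` sample_idx ms k.
Proof. by move=> [a c]; rewrite /sample_idx/=; lia. Qed.

(** Iteration [k] adds only its own samples to the past. The range reaches [N.+1] because the
    telescoping sum ends at that iterate. *)
Let mx k : (1 <= k <= N.+1)%N ->
  measurable_fun setT (x k : past_xi (sample_idx ms k.-1) -> borel 'cV[R]_n).
Proof.
elim: k => [//|k IH kN]; have [->|k0] := posnP k.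
  rewrite (_ : x 1%N = cst x1); last first.
    by apply/funext => w; exact: (rsqn_init rsqn).
  exact: measurable_cst.
have kN' : (1 <= k <= N)%N by lia.
have mxk : measurable_fun setT
    (x k : past_xi (sample_idx ms k.-1) -> borel 'cV[R]_n) by apply: IH; lia.
rewrite (_ : x k.+1 = fun w =>
    x k w - (alpha * h k w) *: minibatch G ms xi k (x k w) w); last first.
  by apply/funext => w; exact: stepE.
apply: (@measurable_subV R n _ (past_xi (sample_idx ms k))).
  exact: (past_sub (@sub_past k) mxk).
apply: (@measurable_scaleV R n _ (past_xi (sample_idx ms k))).
  move=> j; apply: measurable_funM; first exact: measurable_cst.
  exact: (past_sub (@sub_past k) (mh j kN')).
exact: (measurable_minibatch mG k0 mxk).
Qed.

Lemma iterate_past k : (1 <= k <= N)%N ->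
  measurable_fun setT (x k : past_xi (sample_idx ms N) -> borel 'cV[R]_n).
Proof.
move=> kN; apply: (past_sub (D := sample_idx ms k.-1)); last by apply: mx; lia.
by move=> [a c]; rewrite /sample_idx/=; lia.
Qed.

Let mxO k : (1 <= k <= N.+1)%N ->
  measurable_fun setT (x k : Omega -> borel 'cV[R]_n).
Proof.
move=> kN; apply: (past_measurable _ (mx kN)) => -[a c] h1; apply: mxi.
by move: h1; rewrite /sample_idx/=; lia.
Qed.

Let g k w := grad f (x k w).
Let F k w := f (x k w) - flow.
Let noise k w := batch_noise f G xi ms k (x k) w.
Let beta := m ^+ 2 / (2 * L * M ^+ 2).
(* The bounds [m <= h <= M] only hold almost surely; clamping [h] makes the
   coefficient of the cross term bounded everywhere, hence [V] square integrable. *)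
Let hc k w := Num.max m (Num.min M (h k w)).
(** Coefficient of the cross term in the descent inequality: [- alpha t] from the linear part, and
    [L alpha^2 t^2] from the double product in the quadratic part. *)
Let c t := - (alpha * t) + L * alpha ^+ 2 * t ^+ 2.
Let V k w := c (hc k w) *: g k w.

Let alpha0 : 0 < alpha. Proof. by rewrite divr_gt0 ?mulr_gt0 ?exprn_gt0. Qed.
Let beta0 : 0 < beta. Proof. by rewrite divr_gt0 ?mulr_gt0 ?exprn_gt0. Qed.

Let F0 k w : 0 <= F k w.
Proof. by rewrite subr_ge0; exact: (AS1_low as1). Qed.

Let gF k w : dotv (g k w) (g k w) <= 2 * L * F k w.
Proof.
apply: sqr_grad_le => //; [exact: (AS1_diff as1)|exact: (AS1_lip as1)|].
exact: (AS1_low as1).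
Qed.

Let mF k : (1 <= k <= N.+1)%N -> measurable_fun setT (F k).
Proof.
move=> kN; apply: measurable_funB; last exact: measurable_cst.
apply: (measurableT_comp (continuous_measurable_borel _) (mxO kN)) => y.
exact/differentiable_continuous/(AS1_diff as1).
Qed.

Let mg0 : measurable_fun setT (grad f : borel 'cV[R]_n -> borel 'cV[R]_n).
Proof. by apply: continuous_measurable_borelV; exact: (AS1_cont as1). Qed.

Let mg k : (1 <= k <= N.+1)%N -> measurable_fun setT (g k : Omega -> borel 'cV[R]_n).
Proof. by move=> kN; exact: (measurableT_comp mg0 (mxO kN)). Qed.

Let mV k : (1 <= k <= N)%N -> measurable_fun setT
  (V k : past_xi (sample_idx ms k.-1) -> borel 'cV[R]_n).
Proof.
move=> kN; apply: (@measurable_scaleV R n _ (past_xi (sample_idx ms k.-1))).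
  move=> j; have mhc : measurable_fun setT
      (hc k : past_xi (sample_idx ms k.-1) -> R).
    apply: measurable_maxr; first exact: measurable_cst.
    by apply: measurable_minr; [exact: measurable_cst|exact: (mh j kN)].
  apply: measurable_funD.
    by apply: measurableT_comp => //; apply: measurable_funM.
  by apply: measurable_funM => //; exact: measurable_funX.
apply: (measurableT_comp mg0); apply: mx; lia.
Qed.

(** The clamped [hc] lies between 0 and [m + M], which bounds [c] uniformly, and [gF] controls the
    gradient by [F]. *)
Let V_le k w : dotv (V k w) (V k w) <=
  (alpha * (m + M) + L * alpha ^+ 2 * (m + M) ^+ 2) ^+ 2 * (2 * L) * F k w.
Proof.
rewrite dotvZl dotvZr mulrA -expr2 -mulrA.
apply: ler_pM; [exact: sqr_ge0|exact: dotv_ge0| |exact: gF].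
have h0 : 0 <= hc k w by rewrite le_max ltW.
have h1 : hc k w <= m + M.
  by rewrite ge_max lerDl ge_min ltW//= lerDr (ltW m0).
have h2 : hc k w ^+ 2 <= (m + M) ^+ 2 by rewrite ler_sqr ?nnegrE// (le_trans h0).
have h3 : alpha * hc k w <= alpha * (m + M) by rewrite ler_pM2l.
have la : 0 < L * alpha ^+ 2 by rewrite mulr_gt0 ?exprn_gt0.
have h4 : L * alpha ^+ 2 * hc k w ^+ 2 <= L * alpha ^+ 2 * (m + M) ^+ 2.
  by rewrite ler_pM2l.
have h5 : 0 <= alpha * hc k w by rewrite mulr_ge0// ltW.
have h6 : 0 <= L * alpha ^+ 2 * hc k w ^+ 2 by rewrite mulr_ge0 ?exprn_ge0// ltW.
rewrite -[leLHS]real_normK ?num_real// ler_sqr ?nnegrE//; last lra.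
by rewrite ler_norml /c; apply/andP; split; lra.
Qed.

(* With [alpha = m / (L M^2)] and [m <= h <= M], both
   [alpha h - L alpha^2 h^2 / 2 >= beta] and [L alpha^2 h^2 / 2 <= beta]. *)
Let one_step k : (1 <= k <= N)%N -> {ae P, forall w,
  F k.+1 w + beta * dotv (g k w) (g k w) <=
  F k w + (dotv (V k w) (noise k w) + beta * dotv (noise k w) (noise k w))}.
Proof.
move=> kN; apply: filterS (as3 kN) => w [].
rewrite invmx_Bmx -/(h k w) => hm hM.
(* In dimension 0 the Loewner bounds say nothing about [h], but all dot products vanish and the
   iterate cannot move. *)
case: (pickP 'I_n) => [j _|n0]; last first.
  have dot0 (u v : 'cV[R]_n) : dotv u v = 0.
    by apply: big1 => j _; have := n0 j.
  rewrite !dot0 !mulr0 !addr0 /F.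
  by have -> : x k.+1 w = x k w by apply/colP => j; have := n0 j.
have {}hm := loewner_le_scalar j hm; have {}hM := loewner_le_scalar j hM.
have hcE : hc k w = h k w by rewrite /hc (min_idPr hM) (max_idPr hm).
have := descent (AS1_diff as1) (AS1_lip as1) (x k w) (x k.+1 w).
have -> : x k.+1 w - x k w = - (alpha * h k w) *: (g k w + noise k w).
  by rewrite stepE// addrC addrA addNr add0r scaleNr /noise/batch_noise subrKC.
rewrite -/(g k w) /F /V hcE /c.
move: (g k w) (noise k w) (h k w) hm hM => u v t hm hM.
rewrite !(dotvDl, dotvDr, dotvZl, dotvZr) (dotvC v u) => H.
have t0 : 0 < t by apply: lt_le_trans hm.
have LM0 : 0 < L * M ^+ 2 by rewrite mulr_gt0 ?exprn_gt0.
have [L0' M0'] : L != 0 /\ M != 0 by rewrite !gt_eqF.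
have k1 : L * alpha ^+ 2 * t ^+ 2 / 2 <= beta.
  have -> : L * alpha ^+ 2 * t ^+ 2 / 2 = beta * (t ^+ 2 / M ^+ 2).
    by rewrite /beta; field; rewrite L0' M0'.
  rewrite ger_pMr// ler_pdivrMr ?exprn_gt0// mul1r ler_sqr ?nnegrE//; exact: ltW.
have k2 : 2 * beta <= alpha * t.
  have -> : 2 * beta = alpha * m by rewrite /beta; field; rewrite L0' M0'.
  by rewrite ler_pM2l.
have uu := dotv_ge0 u; have vv := dotv_ge0 v.
have k3 : 0 <= (beta - L * alpha ^+ 2 * t ^+ 2 / 2) * dotv v v.
  by rewrite mulr_ge0// subr_ge0.
have k4 : 0 <= (alpha * t - L * alpha ^+ 2 * t ^+ 2 / 2 - beta) * dotv u u.
  by rewrite mulr_ge0//; lra.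
move: k3 k4 H; rewrite !mulrDl !mulrDr; lra.
Qed.

Let IF k := (\int[P]_w (F k w)%:E)%E.
Let Ig k := (\int[P]_w (dotv (g k w) (g k w))%:E)%E.

Let L1_gg k : (1 <= k <= N.+1)%N -> P.-integrable setT (EFin \o F k) ->
  P.-integrable setT (EFin \o (fun w => dotv (g k w) (g k w))).
Proof.
move=> kN F1; apply: L1_le (L1Z (2 * L) F1).
  by apply: measurable_dotv; exact: mg.
by move=> w; rewrite ger0_norm ?dotv_ge0.
Qed.

(** Integrability of [F k] gives that of the gradient and cross terms; returning it for [k.+1] lets
    the estimate be iterated. *)
Let expected_step k : (1 <= k <= N)%N -> P.-integrable setT (EFin \o F k) ->
  P.-integrable setT (EFin \o F k.+1) /\
  (IF k.+1 + beta%:E * Ig k <= IF k + (beta * (sigma ^+ 2 / b%:R))%:E)%E.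
Proof.
move=> kN F1.
have kN1 : (1 <= k <= N.+1)%N by lia.
have kN2 : (1 <= k.+1 <= N.+1)%N by lia.
have mean i := AS2_mean as2 (k := k) (i := i).
have var i := AS2_var as2 (k := k) (i := i).
have nL2 := batch_noise_L2 (AS1_cont as1) mG (AS2_indep as2) mxi kN b0 (mx kN1)
  mean var.
have nvar := batch_noise_var (AS1_cont as1) mG (AS2_indep as2) mxi kN b0 (mx kN1)
  mean var.
have VL2 : P.-integrable setT (EFin \o (fun w => dotv (V k w) (V k w))).
  have mVO : measurable_fun setT (V k : Omega -> borel 'cV[R]_n).
    apply: (past_measurable _ (mV kN)) => -[a e] h1; apply: mxi.
    by move: h1; rewrite /sample_idx/=; lia.
  apply: L1_le (L1Z _ F1); first exact: measurable_dotv.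
  by move=> w; rewrite ger0_norm ?dotv_ge0//; exact: V_le.
have [nV1 nV0] := batch_noise_orthogonal (AS1_cont as1) mG (AS2_indep as2) mxi
  kN b0 (mx kN1) mean var (mV kN) VL2.
pose lhs w := F k.+1 w + beta * dotv (g k w) (g k w).
pose rhs w := F k w + (dotv (V k w) (noise k w) + beta * dotv (noise k w) (noise k w)).
have rhs1 : P.-integrable setT (EFin \o rhs) by exact: L1D F1 (L1D nV1 (L1Z _ nL2)).
have lhs0 w : 0 <= lhs w by rewrite addr_ge0// mulr_ge0 ?dotv_ge0// ltW.
have mgg : measurable_fun setT (fun w => beta * dotv (g k w) (g k w)).
  by apply: measurable_funM => //; apply: measurable_dotv; exact: mg.
have mlhs : measurable_fun setT lhs by apply: measurable_funD => //; exact: mF.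
have le_int : (\int[P]_w (lhs w)%:E <= \int[P]_w (rhs w)%:E)%E.
  (* The right side may be negative on a null set; replacing it by its positive part makes
     monotonicity for nonnegative functions applicable. *)
  have -> : (\int[P]_w (rhs w)%:E = \int[P]_w (Num.max (rhs w) 0)%:E)%E.
    apply: ae_eq_integral => //.
    - exact: measurable_int rhs1.
    - by apply/measurable_EFinP; apply: measurable_maxr => //; exact: L1_measurable rhs1.
    apply: filterS (one_step kN) => w hw _.
    by rewrite max_l// (le_trans (lhs0 w)).
  apply: ae_ge0_le_integral => //.
  - by move=> w _; rewrite lee_fin.
  - exact/measurable_EFinP.
  - by move=> w _; rewrite lee_fin le_max lexx orbT.
  - by apply/measurable_EFinP; apply: measurable_maxr => //; exact: L1_measurable rhs1.
  apply: filterS (one_step kN) => w hw _.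
  by rewrite lee_fin le_max hw.
have Fk1 : (\int[P]_w (lhs w)%:E = IF k.+1 + beta%:E * Ig k)%E.
  under eq_integral do rewrite EFinD.
  rewrite ge0_integralD//; last first.
  - exact/measurable_EFinP.
  - by move=> w _; rewrite lee_fin mulr_ge0 ?dotv_ge0// ltW.
  - by apply/measurable_EFinP; exact: mF.
  - by move=> w _; rewrite lee_fin.
  under [X in (_ + X = _)%E]eq_integral do rewrite EFinM.
  rewrite integralZl//; exact: L1_gg.
have rhs_le : (\int[P]_w (rhs w)%:E <= IF k + (beta * (sigma ^+ 2 / b%:R))%:E)%E.
  under eq_integral do rewrite EFinD.
  rewrite integralD//; last exact: (L1D nV1 (L1Z _ nL2)).
  under [X in (_ + X <= _)%E]eq_integral do rewrite EFinD.
  rewrite integralD//; last exact: (L1Z _ nL2).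
  rewrite nV0 add0e leeD2l//.
  under eq_integral do rewrite EFinM.
  rewrite integralZl// [X in (_ <= X)%E]EFinM lee_wpmul2l//.
  by rewrite lee_fin ltW.
split; last by rewrite -Fk1; exact: le_trans rhs_le.
apply/integrableP; split; first by apply/measurable_EFinP; exact: mF.
(* Finiteness comes from the estimate itself: [0 <= F k.+1 <= lhs], and the integral of [lhs] is at
   most a finite bound. *)
apply: (@le_lt_trans _ _ (\int[P]_w (lhs w)%:E)%E).
  apply: ge0_le_integral => //.
  - by apply/measurable_EFinP; apply: measurableT_comp => //; exact: mF.
  - exact/measurable_EFinP.
  move=> w _; rewrite /= lee_fin ger0_norm// lerDl mulr_ge0 ?dotv_ge0//.
  exact: ltW.
apply: le_lt_trans le_int _.
exact: (le_lt_trans rhs_le (lte_add_pinfty (integrable_lty _ F1) (ltry _))).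
Qed.

Lemma sum_expected_sqr_grad :
  ((m ^+ 2 / (2 * L * M ^+ 2))%:E * \sum_(1 <= k < N.+1)
     \int[P]_w (dotv (grad f (x k w)) (grad f (x k w)))%:E <=
   ((f x1 - flow) +
     N%:R * (m ^+ 2 / (2 * L * M ^+ 2) * (sigma ^+ 2 / b%:R)))%:E)%E.
Proof.
rewrite -[m ^+ 2 / _]/beta -[X in (_ * X)%E]/(\sum_(1 <= k < N.+1) Ig k)%E.
(* Integrability travels with the telescoped bound; at [K = N] the nonnegative [IF N.+1] is
   discarded. *)
suff H K : (K <= N)%N -> P.-integrable setT (EFin \o F K.+1) /\
    (IF K.+1 + beta%:E * \sum_(1 <= k < K.+1) Ig k <=
     ((f x1 - flow) + K%:R * (beta * (sigma ^+ 2 / b%:R)))%:E)%E.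
  have [_] := H N (leqnn _); apply: le_trans.
  rewrite leeDr//; apply: integral_ge0 => w _; rewrite lee_fin; exact: F0.
have Ig0 k : (0 <= Ig k)%E.
  by apply: integral_ge0 => w _; rewrite lee_fin dotv_ge0.
have be0 : (0 <= beta%:E)%E by rewrite lee_fin ltW.
elim: K => [_|K IH KN].
  have F1E : F 1%N = cst (f x1 - flow).
    by apply/funext => w; rewrite /F (rsqn_init rsqn).
  rewrite big_geq// mule0 adde0 mul0r addr0 /IF F1E; split.
    exact: finite_measure_integrable_cst.
  by have := expectation_cst P (f x1 - flow); rewrite unlock => ->.
have [|F1 IHb] := IH _; first exact: ltnW.
have [F2 st] := expected_step (k := K.+1) KN F1.
split=> //.
rewrite big_nat_recr//= ge0_muleDr ?sume_ge0//.
rewrite addeCA; apply: le_trans (leeD2l _ st) _.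
rewrite addeA [X in (X + _ <= _)%E]addeC.
rewrite -natr1 (mulrDl K%:R) mul1r addrA EFinD.
exact: leeD2r.
Qed.

(** * Averaging over the random stopping index *)

Context (Xi : set 'cV[R]_d) (tau : Omega -> nat).
Hypothesis N0 : (0 < N)%N.
Hypothesis rnd : rsqn_random P Xi N ms (pmf_R m L M (fun=> alpha) N) xi tau.

(** A constant stepsize makes every weight equal to [m^2 / (2 L M^2)], which is nonzero, so the law
    is uniform. *)
Let pmfE k : pmf_R m L M (fun=> alpha) N k = N%:R^-1.
Proof.
rewrite /pmf_R sumr_const_nat subSS subn0 -mulr_natr.
have [L0' M0' m0'] : [/\ L != 0, M != 0 & m != 0] by rewrite !gt_eqF.
have N0' : N%:R != 0 :> R by rewrite pnatr_eq0 -lt0n.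
field; rewrite N0' M0' L0' /= (_ : _ - _ = m ^+ 2) ?expf_neq0//; ring.
Qed.

(** The iterate is a function of the samples, hence independent of [tau]; freezing [tau] factors out
    the probability that it equals [k]. *)
Let expected_at k : (1 <= k <= N)%N ->
  (\int[P]_w ((tau w == k)%:R * dotv (g k w) (g k w))%:E = N%:R^-1%:E * Ig k)%E.
Proof.
move=> kN; have kN1 : (1 <= k <= N.+1)%N by lia.
pose phi (z : nat * borel 'cV[R]_n) : \bar R :=
  ((z.1 == k)%:R * dotv (grad f z.2) (grad f z.2))%:E.
have mphi : measurable_fun setT phi.
  apply/measurable_EFinP; apply: measurable_funM.
    by apply: (measurableT_comp (f := fun t : nat => (t == k)%:R : R)).
  by apply: measurable_dotv; exact: (measurableT_comp mg0).
have phi0 z : (0 <= phi z)%E by rewrite lee_fin mulr_ge0 ?dotv_ge0.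
have ind (A : set nat) (B : set (borel 'cV[R]_n)) : measurable A -> measurable B ->
    (P (tau @^-1` A `&` (x k : Omega -> borel 'cV[R]_n) @^-1` B) =
     P (tau @^-1` A) * P ((x k : Omega -> borel 'cV[R]_n) @^-1` B))%E.
  move=> _ mB; apply: (tau_indep rnd).
  by have := iterate_past kN measurableT mB; rewrite setTI.
have := ge0_freezing (tau_measurable rnd) (mxO kN1) ind mphi phi0.
rewrite /phi/= => ->.
transitivity (\int[P]_w ((\1_(tau @^-1` [set k]) w)%:E * Ig k))%E.
  apply: eq_integral => w _; under eq_integral do rewrite EFinM.
  rewrite ge0_integralZl//.
  - rewrite indicE; congr ((nat_of_bool _)%:R%:E * _)%E.
    by apply/eqP/idP; rewrite inE.
  - by apply/measurable_EFinP; apply: measurable_dotv; exact: mg.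
  by move=> w' _; rewrite lee_fin dotv_ge0.
have mtau : measurable (tau @^-1` [set k]).
  by rewrite -[X in measurable X]setTI; exact: (tau_measurable rnd).
rewrite ge0_integralZr//; last first.
- by apply: integral_ge0 => w _; rewrite lee_fin dotv_ge0.
- by apply/measurable_EFinP; exact: measurable_indic.
by rewrite integral_indic// setIT [X in (X * _)%E](tau_pmf rnd)// pmfE.
Qed.

Lemma expected_output :
  ('E_P[(fun w => enorm (grad f (x (tau w) w)) ^+ 2)%R] <=
   (2 * L * M ^+ 2 / m ^+ 2 * (f x1 - flow) / N%:R + sigma ^+ 2 / b%:R)%:E)%E.
Proof.
rewrite unlock.
have E w : enorm (grad f (x (tau w) w)) ^+ 2 =
    \sum_(1 <= k < N.+1) (tau w == k)%:R * dotv (g k w) (g k w).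
  have /andP[t1 tN] := tau_range rnd w.
  rewrite sqr_enorm (bigD1_seq (tau w)) ?iota_uniq ?mem_index_iota ?t1//=.
  rewrite eqxx mul1r big1 ?addr0// => k /negbTE kt.
  by rewrite eq_sym kt mul0r.
under eq_integral do rewrite E big_add1 big_mkord -sumEFin.
have iN (i : 'I_N) : (1 <= i.+1 <= N)%N by rewrite ltn_ord.
rewrite ge0_integral_sum//; last 2 first.
- move=> i; apply/measurable_EFinP; apply: measurable_funM.
    apply: (measurableT_comp (f := fun t : nat => (t == i.+1)%:R : R)) => //.
    exact: (tau_measurable rnd).
  by apply: measurable_dotv; apply: mg; have := ltn_ord i; lia.
- by move=> i w _; rewrite lee_fin mulr_ge0 ?dotv_ge0.
under eq_bigr do rewrite expected_at//.
have Ig0 k : (0 <= Ig k)%E.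
  by apply: integral_ge0 => w _; rewrite lee_fin dotv_ge0.
rewrite -ge0_sume_distrr//.
have be0 : (0 < beta%:E)%E by rewrite lte_fin.
have := sum_expected_sqr_grad; rewrite -[m ^+ 2 / _]/beta big_add1 big_mkord.
rewrite -[X in (_ * X <= _)%E -> _]/(\sum_(i < N) Ig i.+1)%E.
have NR : 0 < N%:R :> R by rewrite ltr0n.
(* The factor [1 / (N beta)] turns the telescoped bound into [Df / (N beta) + sigma^2 / b], where
   [1 / beta = 2 L M^2 / m^2]. *)
move/(lee_wpmul2l (_ : 0 <= ((N%:R * beta)^-1)%:E)%E).
rewrite lee_fin invr_ge0 mulr_ge0 ?(ltW NR) ?(ltW beta0)// => /(_ isT).
rewrite muleA -!EFinM.
have [L0' M0' m0'] : [/\ L != 0, M != 0 & m != 0] by rewrite !gt_eqF.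
have N0' : N%:R != 0 :> R by rewrite gt_eqF.
have bR : b%:R != 0 :> R by rewrite pnatr_eq0 -lt0n.
have -> : (N%:R * beta)^-1 * beta = N%:R^-1.
  by field; rewrite N0' gt_eqF.
move/le_trans; apply; rewrite lee_fin le_eqVlt; apply/orP; left; apply/eqP.
by rewrite /beta; field; rewrite ?N0' ?L0' ?M0' ?m0' ?bR.
Qed.

End iteration.

Theorem theorem4p2 (R : realType) (n d : nat)
    (f : 'cV[R]_n -> R) (flow L : R)
    (G : 'cV[R]_n -> 'cV[R]_d -> 'cV[R]_n) (Xi : set 'cV[R]_d) (sigma : R)
    (x1 : 'cV[R]_n) (lambda1 lmin lmax : R) (q : nat) (m M Dt : R) :
  0 < L -> 0 < sigma -> 0 < lambda1 -> 0 < lmin -> lmin < lmax ->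
  (0 < q)%N -> 0 < m -> 0 < M -> 0 < Dt ->
  AS1 f flow L ->
  measurable_fun setT (fun p : borel 'cV[R]_n * borel 'cV[R]_d =>
    G p.1 p.2 : borel 'cV[R]_n) ->
  let Df := f x1 - flow in
  exists2 K : R -> R, K =O_ (0^'+) (fun eps : R => eps ^- 2) &
  forall (eps : R) (Nbar : nat), 0 < eps ->
  budget_ok sigma L m M Dt Df eps Nbar ->
  let mbar := batch_size sigma L Dt Nbar in
  let ms := fun _ : nat => mbar in
  let N := (Nbar %/ mbar)%N in
  let alpha := fun _ : nat => m / (L * M ^+ 2) in
  forall (dO : measure_display) (Omega : measurableType dO)
    (P : probability Omega R) (zeta : nat -> R)
    (xi : nat * nat -> Omega -> 'cV[R]_d) (tau : Omega -> nat)
    (x : nat -> Omega -> 'cV[R]_n) (lambda : nat -> Omega -> R),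
  (forall k, (1 <= k <= N)%N -> 0 <= zeta k) ->
  rsqn_random P Xi N ms (pmf_R m L M alpha N) xi tau ->
  rsqn_scbb G x1 lambda1 lmin lmax q N ms alpha zeta xi x lambda ->
  AS2 f G sigma P N ms xi x ->
  AS3 m M P N zeta (Bmx n lambda) ->
  AS4 N ms xi (Bmx n lambda) ->
  [/\ ('E_P[(fun w => enorm (grad f (x (tau w) w)) ^+ 2)%R] <= eps%:E)%E,
      forall w, (sfo_calls q ms (tau w))%:Z <=
        Num.ceil (((1 + q) * Nbar)%:R / q%:R : R)
    & (forall N', budget_ok sigma L m M Dt Df eps N' -> (Nbar <= N')%N) ->
      forall w, (sfo_calls q ms (tau w))%:R <= K eps].
Proof.
move=> L0 sigma0 _ _ _ q0 m0 M0 Dt0 as1 mG Df.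
have Df0 : 0 <= Df by rewrite subr_ge0; exact: (AS1_low as1).
(* The bound is chosen before [eps], the probability space and the run, so its order is uniform over
   all of them. *)
exists (sfo_bound sigma L m M Dt Df q); first exact: sfo_bound_bigO.
move=> eps Nbar eps0 budget mbar ms N alpha dO Omega P zeta xi tau x lambda _.
move=> rnd rsqn as2 as3 as4.
have Nbar0 : (0 < Nbar)%N := budget.1.
have mbar0 : (0 < mbar)%N by exact: batch_size_gt0.
have N0 : (0 < N)%N by rewrite divn_gt0// batch_size_le.
have tauN w : (tau w <= N)%N by have /andP[] := tau_range rnd w.
split.
- apply: (le_trans (expected_output L0 m0 M0 as1 mG mbar0 (xi_measurable rnd)
    rsqn as2 as3 as4 N0 rnd)).
  by rewrite lee_fin; exact: rate_le_eps.
- by move=> w; exact: sfo_calls_le_ceil.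
- by move=> minN w; exact: sfo_calls_le_bound (tauN w) minN.
Qed.
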